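(* Consider the special resource allocation game, in which each $f_{il}$ depends only on $(x_{il},\bm{x}_{-i})$, and suppose that Assumptions 1, 2 and 3 (listed in the context) hold. Let the sequences $x_{ij}(k),\eta_{ij}(k),\xi_{ij}^{pq}(k)$ ($k\in\mathbb{N}$; $ij,pq\in\mathcal{V}$) be generated by Algorithm A of the context with step size $\alpha>0$. If $$\alpha\le\min\left\{\frac{\gamma}{8\mu\max_{i\in\mathcal{I}}\{l_i^2\|L_i\|^4\}},\ \frac{\mu}{2\sum_{i=1}^N l_i^2\|L_i\|^2+\gamma b}\right\},$$ where $$\gamma=4\max_{i\in\mathcal{I}}\{l_i^2\|L_i\|^2\},\qquad b=n_{\mathrm{sum}}\left(2\|\mathcal{M}^TW_{\mathcal{M}}\|^2+\|W_{\mathcal{M}}\|\right),$$ then the collective state $\bm{x}(k)$ converges linearly to the Nash equilibrium $\bm{x}^*$ of the game. Moreover, the equality constraints are satisfied at every iteration: $\sum_{j=1}^{n_i}x_{ij}(k)=R_i$ for all $i\in\mathcal{I}$ and all $k\in\mathbb{N}$.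
   Context: **Game.** There are $N\ge1$ coalitions, $\mathcal{I}=\{1,\dots,N\}$. Coalition $i$ has agent set $\mathcal{V}_i=\{ij: j=1,\dots,n_i\}$ ($ij$ is the $j$th member of coalition $i$). $n_{\mathrm{sum}}=\sum_i n_i$ and $\mathcal{V}=\mathcal{V}_1\cup\dots\cup\mathcal{V}_N$; agents are always ordered $11,\dots,1n_1,21,\dots,Nn_N$. Agent $ij$ has decision $x_{ij}\in\mathbb{R}$ and local resource $R_{ij}\in\mathbb{R}$; $R_i=\sum_{j=1}^{n_i}R_{ij}$, $\bm{x}_i=[x_{i1},\dots,x_{in_i}]^T$, $\bm{x}=[\bm{x}_1^T,\dots,\bm{x}_N^T]^T\in\mathbb{R}^{n_{\mathrm{sum}}}$, and $\bm{x}_{-i}$ is $\bm{x}$ with the block $\bm{x}_i$ removed. Agent $ij$ has objective $f_{ij}:\mathbb{R}^{n_{\mathrm{sum}}}\to\mathbb{R}$. In the special game, $f_{ij}(\bm{x})=f_{ij}(x_{ij},\bm{x}_{-i})$, i.e. $f_{ij}$ does not depend on $x_{il}$ for $l\ne j$. Coalition $i$ minimizes $f_i=\sum_{l=1}^{n_i}f_{il}$ over $\bm{x}_i\in\Omega_i=\{\bm{x}_i\in\mathbb{R}^{n_i}:\bm{1}_{n_i}^T\bm{x}_i=R_i\}$. With $\Omega=\prod_i\Omega_i$, a Nash equilibrium (NE) is $\bm{x}^*=(\bm{x}_i^*,\bm{x}_{-i}^* )\in\Omega$ such that for every $i\in\mathcal{I}$, $f_i(\bm{x}_i^*,\bm{x}_{-i}^*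 )\le f_i(\bm{x}_i,\bm{x}_{-i}^* )$ for all $\bm{x}_i\in\Omega_i$. (Assumptions 1 and 2 ensure that the NE exists and is unique.) **Assumption 1.** Each $f_{ij}$ is convex and continuously differentiable, and $\nabla f_{ij}$ is Lipschitz with constant $l_{ij}$. Put $l_i=\sum_{j=1}^{n_i}l_{ij}$. **Assumption 2.** With $\mathcal{P}(\bm{x})=[(\frac{\partial f_1}{\partial\bm{x}_1}(\bm{x}))^T,\dots,(\frac{\partial f_N}{\partial\bm{x}_N}(\bm{x}))^T]^T$, there is a constant $\mu>0$ with $(\bm{a}_1-\bm{a}_2)^T(\mathcal{P}(\bm{a}_1)-\mathcal{P}(\bm{a}_2))\ge\mu\|\bm{a}_1-\bm{a}_2\|^2$ for all $\bm{a}_1,\bm{a}_2\in\mathbb{R}^{n_{\mathrm{sum}}}$. **Assumption 3.** The communication graph $\mathcal{G}(\mathcal{V},\mathcal{E})$ (no self-loops) is undirected and connected, and each induced subgraph $\mathcal{G}_i$ on $\mathcal{V}_i$ is undirected and connected. **Matrices.** $\mathcal{N}_{ij}=\{lm:(lm,ij)\in\mathcal{E}\}$, $\mathcal{N}_{ij}^i=\mathcal{N}_{ij}\cap\mathcal{V}_i$. $L_i\in\mathbb{R}^{n_i\times n_i}$ is the (unweighted) graph Laplacian of $\mathcal{G}_i$. $W=[w_{ij}^{pq}]\in\mathbb{R}^{n_{\mathrm{sum}}\times n_{\mathrm{sum}}}$ (row indexed by $ij$, column by $pq$) is a fixed matrix with $w_{ij}^{ij}=0$, $w_{ij}^{pq}>0$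 if $(pq,ij)\in\mathcal{E}$ and $w_{ij}^{pq}=0$ otherwise, and $\sum_{pq\in\mathcal{V}}w_{ij}^{pq}+\max_{pq\in\mathcal{V}}w_{ij}^{pq}<1$ for all $ij\in\mathcal{V}$. Put $\bar w_{ij}^{pq}=1-\sum_{lm\in\mathcal{N}_{ij}}w_{ij}^{lm}-w_{ij}^{pq}$, $\bar W=\mathrm{diag}\{\bar w_{11}^{11},\dots,\bar w_{11}^{Nn_N},\bar w_{12}^{11},\dots,\bar w_{12}^{Nn_N},\dots,\bar w_{Nn_N}^{Nn_N}\}$ and $\mathcal{M}=W\otimes I_{n_{\mathrm{sum}}}+\bar W\in\mathbb{R}^{n_{\mathrm{sum}}^2\times n_{\mathrm{sum}}^2}$. $W_{\mathcal{M}}$ is a symmetric positive definite matrix with $\mathcal{M}^TW_{\mathcal{M}}\mathcal{M}-W_{\mathcal{M}}=-I_{n_{\mathrm{sum}}^2}$ (it exists because $\mathcal{M}$ is Schur). $\|\cdot\|$ is the Euclidean norm and the induced matrix norm. **Algorithm A.** For all $ij\in\mathcal{V}$, $k\in\mathbb{N}$: $$x_{ij}(k)=x_{ij}(0)-\sum_{im\in\mathcal{N}_{ij}^i}(\eta_{ij}(k)-\eta_{im}(k)),$$ $$\eta_{ij}(k+1)=\eta_{ij}(k)+\alpha\sum_{im\in\mathcal{N}_{ij}^i}\left(\frac{\partial f_{ij}}{\partial x_{ij}}(\xi_{ij}^{ij}(k),\bm{\xi}_{ij}^{-i}(k))-\frac{\partial f_{im}}{\partial x_{im}}(\xi_{im}^{im}(k),\bm{\xi}_{im}^{-i}(k))\right),$$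 $$\xi_{ij}^{pq}(k+1)=\bar w_{ij}^{pq}\xi_{ij}^{pq}(k)+\sum_{lm\in\mathcal{N}_{ij}}w_{ij}^{lm}\xi_{lm}^{pq}(k)+w_{ij}^{pq}x_{pq}(k),\quad\forall pq\in\mathcal{V},$$ with $x_{ij}(0)=R_{ij}$, $\eta_{ij}(0)=0$, and arbitrary real $\xi_{ij}^{pq}(0)$. Here $\bm{\xi}_{ij}^{-i}$ is the vector of all $\xi_{ij}^{pq}$ with $p\ne i$ (agent $ij$'s estimate of $\bm{x}_{-i}$). **Linear convergence** of $\bm{x}(k)$ to $\bm{x}^*$ means that there are $C>0$ and $q\in(0,1)$ with $\|\bm{x}(k)-\bm{x}^*\|\le Cq^k$ for all $k$. *)

(* Defs.v *)
From mathcomp Require Import all_boot all_order all_algebra.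
From mathcomp Require Import mxtens.
From mathcomp Require Import all_classical all_reals all_analysis.

Set Implicit Arguments.
Unset Strict Implicit.
Unset Printing Implicit Defensive.

Import Order.TTheory GRing.Theory Num.Theory.
Import numFieldNormedType.Exports.

Local Open Scope classical_set_scope.
Local Open Scope ring_scope.

(* The agents 11, ..., 1n_1, 21, ..., Nn_N are the elements of
   'I_(\sum_i n i) in this (lexicographic) order: the j-th member of coalition i
   is [tagnat.Rank i j], and [tagnat.sig1 s] is the coalition of the agent s.
   Accordingly [submxcol x i] is the block x_i of a vector x. *)
Notation nsum n := (\sum_i n i)%N.
Notation agent n := 'I_(nsum n).

Section euclidean.
Context {R : realType}.

(* The norm of the normed module 'M[R]_(m, n) is the max norm, which is not the
   one meant here. *)
Definition l2norm m (v : 'cV[R]_m) : R := Num.sqrt (\sum_i v i 0 ^+ 2).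

Definition opnorm m p (A : 'M[R]_(m, p)) : R :=
  sup [set l2norm (A *m v) | v in [set v : 'cV[R]_p | l2norm v <= 1]].

Definition partial m (f : 'cV[R]_m -> R) (s : 'I_m) (x : 'cV[R]_m) : R :=
  'D_(delta_mx s 0) f x.

Definition grad m (f : 'cV[R]_m -> R) (x : 'cV[R]_m) : 'cV[R]_m :=
  \col_s partial f s x.

Definition posdef m (A : 'M[R]_m) : Prop :=
  A^T = A /\ forall v : 'cV[R]_m, v != 0 -> 0 < (v^T *m A *m v) 0 0.

Definition linearly_converges m (x : nat -> 'cV[R]_m) (y : 'cV[R]_m) : Prop :=
  exists C q : R, [/\ 0 < C, 0 < q, q < 1 &
    forall k, l2norm (x k - y) <= C * q ^+ k].

End euclidean.

Section game.
Context {R : realType} {N : nat} {n : 'I_N -> nat}.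
Implicit Types (f : agent n -> 'cV[R]_(nsum n) -> R) (r : 'cV[R]_(nsum n)).

(* f_s depends only on x_s and on the decisions of the other coalitions *)
Definition special_game f : Prop :=
  forall (s : agent n) (x y : 'cV[R]_(nsum n)),
    x s 0 = y s 0 ->
    (forall t : agent n, tagnat.sig1 t != tagnat.sig1 s -> x t 0 = y t 0) ->
    f s x = f s y.

Definition coalition_objective f (i : 'I_N) (x : 'cV[R]_(nsum n)) : R :=
  \sum_(j < n i) f (tagnat.Rank i j) x.

Definition coalition_resource r (i : 'I_N) : R :=
  \sum_(j < n i) r (tagnat.Rank i j) 0.

Definition feasible r (i : 'I_N) : set 'cV[R]_(n i) :=
  [set y | \sum_j y j 0 = coalition_resource r i].
Arguments feasible r i : clear implicits.

(* the vector (y, x_{-i}) *)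
Definition replace_block (x : 'cV[R]_(nsum n)) (i : 'I_N) (y : 'cV[R]_(n i)) :
    'cV[R]_(nsum n) :=
  \mxcol_p dfwith (fun q => submxcol x q) i y p.

Definition is_NE f r (x : 'cV[R]_(nsum n)) : Prop :=
  (forall i, feasible r i (submxcol x i)) /\
  forall i (y : 'cV[R]_(n i)), feasible r i y ->
    coalition_objective f i x <= coalition_objective f i (replace_block x y).

Definition smooth_convex f (l : agent n -> R) : Prop :=
  forall s,
    [/\ convex_function [set: 'cV[R]_(nsum n)] (f s),
        forall x, differentiable (f s) x,
        continuous (grad (f s)) &
        forall x y, l2norm (grad (f s) x - grad (f s) y) <= l s * l2norm (x - y)].

Definition coalition_lipschitz (l : agent n -> R) (i : 'I_N) : R :=
  \sum_(j < n i) l (tagnat.Rank i j).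

Definition pseudo_gradient f (x : 'cV[R]_(nsum n)) : 'cV[R]_(nsum n) :=
  \mxcol_i submxcol (grad (coalition_objective f i) x) i.

Definition strongly_monotone_game f (mu : R) : Prop :=
  0 < mu /\
  forall a1 a2 : 'cV[R]_(nsum n),
    mu * l2norm (a1 - a2) ^+ 2 <=
    ((a1 - a2)^T *m (pseudo_gradient f a1 - pseudo_gradient f a2)) 0 0.

End game.

Section network.
Context {R : realType} {N : nat} {n : 'I_N -> nat}.
Implicit Types (E : rel (agent n)) (W : 'M[R]_(nsum n)).

Definition induced E (i : 'I_N) : rel 'I_(n i) :=
  fun j m => E (tagnat.Rank i j) (tagnat.Rank i m).
Arguments induced E i : clear implicits.

Definition connected_network E : Prop :=
  [/\ irreflexive E, symmetric E, forall s t, connect E s t &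
      forall i, symmetric (induced E i) /\
                forall j m, connect (induced E i) j m].

Definition neighbors E (s : agent n) : {set agent n} := [set t | E t s].

Definition coalition_neighbors E (s : agent n) : {set agent n} :=
  [set t in neighbors E s | tagnat.sig1 t == tagnat.sig1 s].

Definition laplacian E (i : 'I_N) : 'M[R]_(n i) :=
  \matrix_(j, m) ((j == m)%:R * #|[set p | induced E i p j]|%:R
                  - (induced E i m j)%:R).

(* W s t is the weight $w_s^t$. The weights are nonnegative, so 0 is a neutral
   element of the maximum. *)
Definition weight_matrix E W : Prop :=
  [/\ forall s, W s s = 0,
      forall s t, E t s -> 0 < W s t,
      forall s t, ~~ E t s -> W s t = 0 &
      forall s, \sum_t W s t + \big[Num.max/0]_t W s t < 1].

Definition wbar E W (s t : agent n) : R :=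
  1 - \sum_(u in neighbors E s) W s u - W s t.

(* The pair (ij, pq), in lexicographic order, is the index of the estimate by
   agent ij of the decision of agent pq. *)
Definition Wbar E W : 'M[R]_(nsum n * nsum n) :=
  diag_mx (\row_k wbar E W (mxtens_unindex k).1 (mxtens_unindex k).2).

Definition estimator_mx E W : 'M[R]_(nsum n * nsum n) :=
  tensmx W (1%:M : 'M[R]_(nsum n)) + Wbar E W.

(* The argument $(\xi_s^s, \xi_s^{-i})$ of the partial derivative of f_s used by
   agent s of coalition i; f_s is insensitive to the remaining coordinates,
   which are set to 0. *)
Definition estimate_arg (xi : 'M[R]_(nsum n)) (s : agent n) : 'cV[R]_(nsum n) :=
  \col_t (if (t == s) || (tagnat.sig1 t != tagnat.sig1 s) then xi s t else 0).

Definition algorithm (f : agent n -> 'cV[R]_(nsum n) -> R)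
    (r : 'cV[R]_(nsum n)) E W (alpha : R)
    (x eta : nat -> 'cV[R]_(nsum n)) (xi : nat -> 'M[R]_(nsum n)) : Prop :=
  let g k s := partial (f s) s (estimate_arg (xi k) s) in
  [/\ x 0%N = r /\ eta 0%N = 0,
      forall k s, x k s 0 = x 0%N s 0
        - \sum_(t in coalition_neighbors E s) (eta k s 0 - eta k t 0),
      forall k s, eta k.+1 s 0 = eta k s 0
        + alpha * \sum_(t in coalition_neighbors E s) (g k s - g k t) &
      forall k s t, xi k.+1 s t = wbar E W s t * xi k s t
        + \sum_(u in neighbors E s) W s u * xi k u t + W s t * x k t 0].

End network.
Arguments laplacian R {N n} E i.

Section step_size.
Context {R : realType} {N : nat} {n : 'I_N -> nat}.
Variables (E : rel (agent n)) (l : agent n -> R).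

Definition gamma : R :=
  4 * \big[Num.max/0]_(i < N)
        (coalition_lipschitz l i ^+ 2 * opnorm (laplacian R E i) ^+ 2).

Definition bconst (W : 'M[R]_(nsum n)) (WM : 'M[R]_(nsum n * nsum n)) : R :=
  (nsum n)%:R *
  (2 * opnorm ((estimator_mx E W)^T *m WM) ^+ 2 + opnorm WM).

Definition step_bound (mu : R) (W : 'M[R]_(nsum n))
    (WM : 'M[R]_(nsum n * nsum n)) : R :=
  Num.min
    (gamma / (8 * mu * \big[Num.max/0]_(i < N)
        (coalition_lipschitz l i ^+ 2 * opnorm (laplacian R E i) ^+ 4)))
    (mu / (2 * (\sum_(i < N)
        coalition_lipschitz l i ^+ 2 * opnorm (laplacian R E i) ^+ 2)
      + gamma * bconst W WM)).

End step_size.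

(* Main.v *)
(* Let L be the block-diagonal Laplacian of the coalition graphs and P the
   pseudo-gradient. The decisions are x = r - L eta, the equilibria are the
   feasible points where P is constant on each coalition, i.e. L P = 0, and one
   of them, xs = r - L etas, is the limit of the gradient iteration with exact
   decisions, a contraction in eta. With e the estimation error, D = |x - xs|^2
   and c = 5 alpha m2 / mu, m2 = max_i l_i^2 |L_i|^2 = gamma / 4, the function
     V = |eta - etas|^2 + c e^T WM e
   decreases by at least a multiple of D + |e|^2, hence geometrically, since
   eta - etas lies in the range of L and is thus controlled by L (eta - etas).
   The decrease of V involves S4 = sum_i l_i^2 |L_i|^4, which does not occur in
   the step-size bound. It is absorbed through S4 <= m2 (sum_i n_i)^2, from
   |L_i| <= n_i, and the lower bound b >= (sum_i n_i)^2 / 2 on the constant b,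
   from the Lyapunov equation. Two more a priori bounds are needed: mu <= l_s
   for every agent s, and |L_i|^2 >= 2 unless L_i = 0. *)
Require Import Defs.
From mathcomp Require Import all_boot all_order all_algebra.
From mathcomp Require Import all_classical all_reals all_analysis.
From mathcomp Require Import mxtens ring lra.

Set Implicit Arguments.
Unset Strict Implicit.
Unset Printing Implicit Defensive.

Import Order.TTheory GRing.Theory Num.Theory.
Import numFieldNormedType.Exports.

Local Open Scope ring_scope.

(** * Euclidean and operator norms *)

Section euclidean_norm.
Context {R : realType}.

Definition dot m (u v : 'cV[R]_m) : R := \sum_i u i 0 * v i 0.

Lemma dotE m (u v : 'cV[R]_m) : (u^T *m v) 0 0 = dot u v.
Proof. by rewrite mxE; apply: eq_bigr => i _; rewrite mxE. Qed.

Lemma dotC m (u v : 'cV[R]_m) : dot u v = dot v u.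
Proof. by apply: eq_bigr => i _; rewrite mulrC. Qed.

Lemma dotDl m (u v w : 'cV[R]_m) : dot (u + v) w = dot u w + dot v w.
Proof. by rewrite -big_split; apply: eq_bigr => i _; rewrite mxE mulrDl. Qed.

Lemma dotZl m a (u v : 'cV[R]_m) : dot (a *: u) v = a * dot u v.
Proof. by rewrite mulr_sumr; apply: eq_bigr => i _; rewrite mxE mulrA. Qed.

Lemma dotNl m (u v : 'cV[R]_m) : dot (- u) v = - dot u v.
Proof. by rewrite -scaleN1r dotZl mulN1r. Qed.

Lemma dotBl m (u v w : 'cV[R]_m) : dot (u - v) w = dot u w - dot v w.
Proof. by rewrite dotDl dotNl. Qed.

Lemma dot0l m (v : 'cV[R]_m) : dot 0 v = 0.
Proof. by rewrite -(scale0r v) dotZl mul0r. Qed.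

Lemma dotDr m (u v w : 'cV[R]_m) : dot w (u + v) = dot w u + dot w v.
Proof. by rewrite !(dotC w) dotDl. Qed.

Lemma dotZr m a (u v : 'cV[R]_m) : dot u (a *: v) = a * dot u v.
Proof. by rewrite !(dotC u) dotZl. Qed.

Lemma dotNr m (u v : 'cV[R]_m) : dot u (- v) = - dot u v.
Proof. by rewrite !(dotC u) dotNl. Qed.

Lemma dotBr m (u v w : 'cV[R]_m) : dot w (u - v) = dot w u - dot w v.
Proof. by rewrite !(dotC w) dotBl. Qed.

Lemma dot0r m (v : 'cV[R]_m) : dot v 0 = 0.
Proof. by rewrite dotC dot0l. Qed.

Definition dot_lin := (dotDl, dotDr, dotBl, dotBr, dotNl, dotNr, dotZl, dotZr).

Lemma dot_delta m (s : 'I_m) (v : 'cV[R]_m) : dot (delta_mx s 0) v = v s 0.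
Proof.
rewrite /dot (bigD1 s)//= mxE !eqxx mul1r big1 ?addr0// => i /negPf is_.
by rewrite mxE is_ mul0r.
Qed.

Lemma dot_mulmx m p (A : 'M[R]_(m, p)) u v : dot (A *m u) v = dot u (A^T *m v).
Proof. by rewrite -!dotE trmx_mul mulmxA. Qed.

Lemma dot_ge0 m (v : 'cV[R]_m) : 0 <= dot v v.
Proof. by apply: sumr_ge0 => i _; rewrite -expr2 sqr_ge0. Qed.

Lemma sqr_le_dot m (v : 'cV[R]_m) i : v i 0 ^+ 2 <= dot v v.
Proof.
rewrite /dot (bigD1 i)//= -expr2 lerDl; apply: sumr_ge0 => j _.
by rewrite -expr2 sqr_ge0.
Qed.

Lemma dot_eq0 m (v : 'cV[R]_m) : dot v v = 0 -> v = 0.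
Proof.
move=> v0; apply/matrixP => i j; rewrite ord1 mxE; apply/eqP.
by rewrite -sqrf_eq0 eq_le sqr_ge0 andbT -v0 sqr_le_dot.
Qed.

Lemma l2norm_sq m (v : 'cV[R]_m) : l2norm v ^+ 2 = dot v v.
Proof.
rewrite /l2norm sqr_sqrtr; last by apply: sumr_ge0 => i _; exact: sqr_ge0.
by apply: eq_bigr => i _; rewrite expr2.
Qed.

Lemma l2normE m (v : 'cV[R]_m) : l2norm v = Num.sqrt (dot v v).
Proof. by rewrite -l2norm_sq sqrtr_sqr ger0_norm// sqrtr_ge0. Qed.

Lemma l2norm_ge0 m (v : 'cV[R]_m) : 0 <= l2norm v.
Proof. exact: sqrtr_ge0. Qed.

Lemma dot_young m t (u v : 'cV[R]_m) : 0 < t ->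
  2 * dot u v <= t * dot u u + t^-1 * dot v v.
Proof.
move=> t0; have := dot_ge0 (t *: u - v).
rewrite !dot_lin (dotC v u) => h.
rewrite -subr_ge0 -(pmulr_rge0 _ t0) mulrBr mulrDr [t * (t^-1 * _)]mulrA.
by rewrite divff ?gt_eqF// mul1r; lra.
Qed.

(** Expand the square of [dot v v *: u - dot u v *: v] and divide by [dot v v]. *)
Lemma cauchy_schwarz m (u v : 'cV[R]_m) : dot u v ^+ 2 <= dot u u * dot v v.
Proof.
have [v0|vn0] := eqVneq (dot v v) 0.
  by rewrite (dot_eq0 v0) !dot0r mulr0 expr0n.
have v0 : 0 < dot v v by rewrite lt_def vn0 dot_ge0.
have := dot_ge0 (dot v v *: u - dot u v *: v).
rewrite !dot_lin (dotC v u) => h.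
rewrite -subr_ge0 -(pmulr_rge0 _ v0) expr2; lra.
Qed.

Lemma sqn_mulmx_frobenius m p (A : 'M[R]_(m, p)) v :
  dot (A *m v) (A *m v) <= (\sum_i \sum_j A i j ^+ 2) * dot v v.
Proof.
rewrite mulr_suml; apply: ler_sum => i _; rewrite -expr2.
have := cauchy_schwarz (row i A)^T v; rewrite -dotE trmxK -row_mul mxE.
by move=> /le_trans; apply; rewrite ler_wpM2r ?dot_ge0// /dot;
  apply: ler_sum => j _; rewrite !mxE expr2.
Qed.

Lemma l2norm_le m (v : 'cV[R]_m) c : 0 <= c ->
  (l2norm v <= c) = (dot v v <= c ^+ 2).
Proof. by move=> c0; rewrite -l2norm_sq ler_sqr// nnegrE l2norm_ge0. Qed.

(** The Frobenius norm is an upper bound. This makes the [sup] in [opnorm] a genuine supremum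
    instead of a default value. *)
Lemma opnorm_has_sup m p (A : 'M[R]_(m, p)) :
  has_sup [set l2norm (A *m v) | v in [set v : 'cV[R]_p | l2norm v <= 1]]%classic.
Proof.
split; first by exists (l2norm (A *m 0)), 0 => //=; rewrite l2norm_le// dot0l.
exists (Num.sqrt (\sum_i \sum_j A i j ^+ 2)) => _ [v /= v1 <-].
have F0 : 0 <= \sum_i \sum_j A i j ^+ 2.
  by apply: sumr_ge0 => i _; apply: sumr_ge0 => j _; exact: sqr_ge0.
rewrite l2norm_le ?sqrtr_ge0// sqr_sqrtr//.
apply: le_trans (sqn_mulmx_frobenius A v) _; rewrite ler_piMr//.
by rewrite l2norm_le// expr1n in v1.
Qed.

Lemma opnorm_ge0 m p (A : 'M[R]_(m, p)) : 0 <= opnorm A.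
Proof.
apply: le_trans (l2norm_ge0 (A *m 0)) _; apply: ub_le_sup.
  by case: (opnorm_has_sup A).
by exists 0 => //=; rewrite l2norm_le// dot0l.
Qed.

Lemma sqn_mulmx_le m p (A : 'M[R]_(m, p)) v :
  dot (A *m v) (A *m v) <= opnorm A ^+ 2 * dot v v.
Proof.
have [v0|vn0] := eqVneq (dot v v) 0.
  by rewrite (dot_eq0 v0) mulmx0 !dot0r mulr0.
have v0 : 0 < dot v v by rewrite lt_def vn0 dot_ge0.
have nv0 : 0 < l2norm v by rewrite l2normE sqrtr_gt0.
have : l2norm (A *m ((l2norm v)^-1 *: v)) <= opnorm A.
  apply: ub_le_sup; first by case: (opnorm_has_sup A).
  exists ((l2norm v)^-1 *: v) => //=.
  rewrite l2norm_le// !dot_lin -l2norm_sq mulrA -invfM -expr2 mulVf ?expr1n//.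
  by rewrite expf_neq0// gt_eqF.
rewrite l2norm_le ?opnorm_ge0// -scalemxAr !dot_lin mulrA -invfM -expr2 l2norm_sq.
by rewrite mulrC ler_pdivrMr.
Qed.

Lemma opnorm_le m p (A : 'M[R]_(m, p)) c : 0 <= c ->
  (forall v, dot (A *m v) (A *m v) <= c ^+ 2 * dot v v) -> opnorm A <= c.
Proof.
move=> c0 Ac; apply: ge_sup; first by case: (opnorm_has_sup A).
move=> _ [v /= v1 <-]; rewrite l2norm_le//; apply: le_trans (Ac v) _.
by rewrite ler_piMr ?sqr_ge0//; rewrite l2norm_le// expr1n in v1.
Qed.

Lemma opnorm0 m p : opnorm (0 : 'M[R]_(m, p)) = 0.
Proof.
apply/eqP; rewrite eq_le opnorm_ge0 andbT opnorm_le// => v.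
by rewrite mul0mx dot0l expr0n mul0r.
Qed.

Lemma dot_mulmx_le m (A : 'M[R]_m) v : dot v (A *m v) <= opnorm A * dot v v.
Proof.
have A0 := opnorm_ge0 A; have v0 := dot_ge0 v.
have h : dot v (A *m v) ^+ 2 <= (opnorm A * dot v v) ^+ 2.
  apply: le_trans (cauchy_schwarz _ _) _.
  rewrite exprMn expr2 [_ * (_ * _)]mulrCA ler_wpM2l// -expr2.
  exact: sqn_mulmx_le.
apply: le_trans (ler_norm _) _.
by rewrite -(@ler_pXn2r _ 2) ?nnegrE ?mulr_ge0// real_normK// num_real.
Qed.

End euclidean_norm.

(** * The estimation error *)

Section estimator.
Context {R : realType}.

(** The Lyapunov equation gives a decrease of |e|^2. Half of it is spent, by Young's inequality, on
    the cross term between [e] and [delta]; this produces the factor 2 in front of |M^T WM|^2 in the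
    constant b. *)
Lemma lyapunov_estimator q (M WM : 'M[R]_q) (e delta : 'cV[R]_q) :
  posdef WM -> M^T *m WM *m M - WM = - 1%:M ->
  dot (M *m e - delta) (WM *m (M *m e - delta)) <=
  dot e (WM *m e) - 2^-1 * dot e e
  + (2 * opnorm (M^T *m WM) ^+ 2 + opnorm WM) * dot delta delta.
Proof.
move=> [WMsym _] MWM.
have quad : dot (M *m e) (WM *m (M *m e)) = dot e (WM *m e) - dot e e.
  rewrite dot_mulmx !mulmxA; move/eqP: MWM; rewrite subr_eq => /eqP ->.
  by rewrite mulmxDl mulNmx mul1mx dotDr dotNr addrC.
have cross : dot delta (WM *m (M *m e)) = dot e (M^T *m WM *m delta).
  by rewrite dotC dot_mulmx WMsym dot_mulmx mulmxA.
have cross' : dot (M *m e) (WM *m delta) = dot e (M^T *m WM *m delta).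
  by rewrite dot_mulmx mulmxA.
rewrite mulmxBr !dot_lin quad cross cross'.
have young : 2 * dot e (- (M^T *m WM *m delta)) <=
    2^-1 * dot e e
    + (2^-1)^-1 * dot (- (M^T *m WM *m delta)) (- (M^T *m WM *m delta)).
  by apply: dot_young; rewrite invr_gt0.
rewrite invrK !dotNr dotNl opprK in young.
have := sqn_mulmx_le (M^T *m WM) delta.
have := dot_mulmx_le WM delta.
set X := dot e (_ *m delta) in young *; set Y := dot delta (WM *m delta).
set K2 := opnorm (M^T *m WM) ^+ 2; set w := opnorm WM.
set Z := dot (_ *m delta) (_ *m delta) in young *.
rewrite mulrDl -[2 * K2 * _]mulrA.
set a := K2 * _; set b := w * _; lra.
Qed.

(** Row-major stacking, in the index order of [estimator_mx]: the matrix of estimates becomes the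
    vector on which the estimator acts. *)
Definition vecmx m p (A : 'M[R]_(m, p)) : 'cV[R]_(m * p) :=
  \col_k A (mxtens_unindex k).1 (mxtens_unindex k).2.

Lemma sum_mxtens m p (F : 'I_m -> 'I_p -> R) :
  \sum_(k < m * p) F (mxtens_unindex k).1 (mxtens_unindex k).2 =
  \sum_i \sum_j F i j.
Proof.
rewrite pair_big; symmetry; rewrite (reindex (@mxtens_unindex m p)) //=.
by exists (@mxtens_index m p) => i _; rewrite (mxtens_indexK, mxtens_unindexK).
Qed.

Lemma dot_vecmx m p (A B : 'M[R]_(m, p)) :
  dot (vecmx A) (vecmx B) = \sum_i \sum_j A i j * B i j.
Proof.
rewrite -sum_mxtens; apply: eq_bigr => k _; by rewrite !mxE.
Qed.

Lemma vecmxD m p (A B : 'M[R]_(m, p)) : vecmx (A + B) = vecmx A + vecmx B.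
Proof. by apply/matrixP => i j; rewrite !mxE. Qed.

Lemma vecmxN m p (A : 'M[R]_(m, p)) : vecmx (- A) = - vecmx A.
Proof. by apply/matrixP => i j; rewrite !mxE. Qed.

Lemma vecmxB m p (A B : 'M[R]_(m, p)) : vecmx (A - B) = vecmx A - vecmx B.
Proof. by rewrite vecmxD vecmxN. Qed.

End estimator.

(** Convexity of the square for weights of total mass at most 1: expand the nonnegative weighted
    variance around the weighted sum c. The missing mass only adds a nonnegative multiple of c^2. *)
Lemma jensen_sqr {R : realType} (I : finType) (b a : R) (p F : I -> R) :
  0 <= b -> (forall u, 0 <= p u) -> b + \sum_u p u <= 1 ->
  (b * a + \sum_u p u * F u) ^+ 2 <= b * a ^+ 2 + \sum_u p u * F u ^+ 2.
Proof.
move=> b0 p0 bp; set c := b * a + _.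
have : 0 <= b * (a - c) ^+ 2 + \sum_u p u * (F u - c) ^+ 2.
  apply: addr_ge0; first by rewrite mulr_ge0 ?sqr_ge0.
  by apply: sumr_ge0 => u _; rewrite mulr_ge0 ?sqr_ge0.
have -> : \sum_u p u * (F u - c) ^+ 2 = \sum_u p u * F u ^+ 2
    - 2 * c * (\sum_u p u * F u) + c ^+ 2 * \sum_u p u.
  rewrite !mulr_sumr -sumrB -big_split; apply: eq_bigr => u _ /=; ring.
have -> : \sum_u p u * F u = c - b * a by rewrite /c; ring.
have := sqr_ge0 c; set q := \sum_u p u in bp *; nra.
Qed.

(** * Estimator weights and the lower bound on the constant b *)

Section weights.
Context {R : realType} {N : nat} {n : 'I_N -> nat}.
Variables (E : rel (agent n)) (W : 'M[R]_(nsum n)).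
Hypothesis hW : weight_matrix E W.

Let W0 s t : 0 <= W s t.
Proof.
case: hW => _ Wpos Wnul _; have [/Wpos/ltW //|/Wnul ->//] := boolP (E t s).
Qed.

Let sum_neighbors s (F : agent n -> R) :
  \sum_(u in neighbors E s) W s u * F u = \sum_u W s u * F u.
Proof.
case: hW => _ _ Wnul _; rewrite [RHS](bigID (mem (neighbors E s)))/=.
rewrite [X in _ = _ + X]big1 ?addr0// => u; rewrite inE => /Wnul ->.
by rewrite mul0r.
Qed.

Lemma wbarE s t : wbar E W s t = 1 - \sum_u W s u - W s t.
Proof.
rewrite /wbar; congr (_ - _ - _).
have h := sum_neighbors s (fun=> 1).
rewrite (eq_bigr (fun u => W s u * 1)) => [|u _]; last by rewrite mulr1.
by rewrite h; apply: eq_bigr => u _; rewrite mulr1.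
Qed.

Lemma estimator_vecmx (A : 'M[R]_(nsum n)) :
  estimator_mx E W *m vecmx A =
  vecmx (\matrix_(s, t) (wbar E W s t * A s t
    + \sum_(u in neighbors E s) W s u * A u t)).
Proof.
apply/matrixP => k j; rewrite {}[j]ord1.
case: (mxtens_indexP k) => s t.
rewrite mulmxDl mxE [X in _ + X]mxE (bigD1 (mxtens_index (s, t)))//=.
rewrite [X in _ + (_ + X)]big1 ?addr0 => [|h /negPf hst]; last first.
  by rewrite !mxE eq_sym hst mulr0n mul0r.
rewrite !mxE eqxx mulr1n !mxtens_indexK/= addrC; congr (_ + _).
rewrite sum_neighbors.
rewrite (eq_bigr (fun h => (fun u v => W s u * (t == v)%:R * A u v)
    (mxtens_unindex h).1 (mxtens_unindex h).2)); last first.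
  by move=> h _; rewrite !mxE !mxtens_indexK.
rewrite (sum_mxtens (fun u v => W s u * (t == v)%:R * A u v)).
apply: eq_bigr => u _.
rewrite (bigD1 t)//= eqxx mulr1 [X in _ + X]big1 ?addr0// => v.
rewrite eq_sym => /negPf ->.
by rewrite mulr0 mul0r.
Qed.

Let sumW s : \sum_t W s t < 1.
Proof.
case: hW => _ _ _ /(_ s); apply: le_lt_trans; rewrite lerDl.
by apply: bigmax_ge_id.
Qed.

(** The sum of squares is at most max times sum, and two nonnegative numbers of sum below 1 have
    product at most 1/4. *)
Let sumW2 s : \sum_t W s t ^+ 2 <= 4^-1.
Proof.
case: hW => _ _ _ /(_ s); set m := \big[Num.max/0]_t W s t.
set S := \sum_t W s t => mS.
have m0 : 0 <= m by apply: bigmax_ge_id.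
apply: (@le_trans _ _ (m * S)).
  rewrite mulr_sumr; apply: ler_sum => t _; rewrite expr2 ler_wpM2r ?W0//.
  exact: (le_bigmax _ (W s)).
have S0 : 0 <= S by apply: sumr_ge0.
have : 0 <= (m - S) ^+ 2 by exact: sqr_ge0.
nra.
Qed.

Let wbar_ge0 s t : 0 <= wbar E W s t.
Proof.
rewrite wbarE; case: hW => _ _ _ /(_ s).
have := le_bigmax (0:R) (W s) t; lra.
Qed.

(* Testing [M^T WM M - WM = -1] on the all-ones vector v, for which
   [v - M v = w] is the vector of the weights, yields
   [v^T M^T WM (w + M w) = nsum^2 - sum w], while w and M w are short:
   |w|^2, |M w|^2 <= nsum / 4. *)
Lemma bconst_ge (WM : 'M[R]_(nsum n * nsum n)) :
  (1 < nsum n)%N -> posdef WM ->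
  (estimator_mx E W)^T *m WM *m estimator_mx E W - WM = - 1%:M ->
  (nsum n)%:R ^+ 2 / 2 <= bconst E W WM.
Proof.
move=> n1 [WMsym _] MWM; set M := estimator_mx E W in MWM *.
pose m : R := (nsum n)%:R.
have m2 : 2 <= m by rewrite ler_nat.
pose v := vecmx (const_mx 1 : 'M[R]_(nsum n)); pose w := vecmx W.
pose K := M^T *m WM.
have vw (A : 'M[R]_(nsum n)) : dot v (vecmx A) = \sum_s \sum_t A s t.
  by rewrite dot_vecmx; apply: eq_bigr => s _; apply: eq_bigr => t _;
    rewrite mxE mul1r.
have vv : dot v v = m ^+ 2.
  rewrite vw expr2 [RHS]mulr_natl -[X in _ *+ X](card_ord (nsum n)) -sumr_const.
  apply: eq_bigr => s _; rewrite -[RHS]mulr1 mulr_natl.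
  rewrite -[X in _ *+ X](card_ord (nsum n)) -sumr_const.
  by apply: eq_bigr => t _; rewrite mxE.
have Mv : M *m v = v - w.
  rewrite estimator_vecmx -vecmxB; congr vecmx.
  apply/matrixP => s t; rewrite !mxE sum_neighbors wbarE mulr1.
  rewrite [X in _ + X](_ : _ = \sum_u W s u); first by ring.
  by apply: eq_bigr => u _; rewrite mxE mulr1.
have ww : dot w w <= m / 4.
  rewrite dot_vecmx mulr_natl -[X in _ *+ X](card_ord (nsum n)) -sumr_const.
  apply: ler_sum => s _; apply: le_trans (sumW2 s).
  by apply: ler_sum => t _; rewrite expr2.
(* Each row of M has nonnegative entries of sum 1 - W s t <= 1, so [jensen_sqr] applies entrywise.
   Summing over t turns the result into a convex combination of row sums of squares, each at most
   1/4. *)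
have MwMw : dot (M *m w) (M *m w) <= m / 4.
  rewrite estimator_vecmx dot_vecmx mulr_natl.
  rewrite -[X in _ *+ X](card_ord (nsum n)) -sumr_const.
  apply: ler_sum => s _.
  apply: (@le_trans _ _ (\sum_t (wbar E W s t * W s t ^+ 2
                                 + \sum_u W s u * W u t ^+ 2))).
    apply: ler_sum => t _; rewrite -expr2 mxE sum_neighbors.
    apply: jensen_sqr => //; rewrite wbarE; have := W0 s t; lra.
  rewrite big_split/= exchange_big/=.
  apply: (@le_trans _ _ ((1 - \sum_u W s u) * 4^-1 + \sum_u W s u * 4^-1)).
    apply: lerD.
      apply: (@le_trans _ _ ((1 - \sum_u W s u) * \sum_t W s t ^+ 2)).
        rewrite mulr_sumr; apply: ler_sum => t _; rewrite ler_wpM2r ?sqr_ge0//.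
        by rewrite wbarE gerBl.
      by rewrite ler_wpM2l// subr_ge0 ltW.
    by apply: ler_sum => u _; rewrite -mulr_sumr ler_wpM2l.
  by rewrite -mulr_suml -mulrDl subrK mul1r.
have vKa : dot v (K *m (w + M *m w)) = m ^+ 2 - \sum_s \sum_t W s t.
  have KM : K *m M = WM - 1%:M by rewrite -MWM addrC subrK.
  have wWv : dot w (WM *m v) = dot v w + dot v (K *m (M *m w)).
    rewrite mulmxA KM mulmxBl mul1mx dotBr addrC subrK.
    by rewrite dotC dot_mulmx WMsym.
  have : dot (M *m v) (WM *m (M *m v)) = dot v (WM *m v) - m ^+ 2.
    rewrite dot_mulmx !mulmxA -/K KM mulmxBl mul1mx dotBr vv.
    by [].
  have -> : WM *m (M *m v) = WM *m v - WM *m w by rewrite Mv mulmxBr.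
  rewrite dotBr Mv !dotBl => h.
  have : dot (M *m v) (WM *m w) = dot v (K *m w).
    by rewrite dot_mulmx mulmxA.
  rewrite Mv dotBl => h2.
  rewrite mulmxDr dotDr -vw -/w; move: h h2 wWv; lra.
have sW : \sum_s \sum_t W s t <= m.
  rewrite -[m]mulr1 mulr_natl -[X in _ *+ X](card_ord (nsum n)) -sumr_const.
  by apply: ler_sum => s _; apply/ltW/sumW.
(* On the left, m^2 - sum w >= m^2 - m >= m^2 / 2 because m >= 2. On the right, Cauchy-Schwarz with
   |v|^2 = m^2 and |w + M w|^2 <= m. *)
have K2 : (m ^+ 2 / 2) ^+ 2 <= m ^+ 3 * opnorm K ^+ 2.
  apply: (@le_trans _ _ (dot v (K *m (w + M *m w)) ^+ 2)).
    have m2m : 2 * m <= m ^+ 2 by rewrite expr2 ler_wpM2r// (le_trans _ m2).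
    by rewrite ler_sqr ?nnegrE ?vKa; move: m2 m2m sW; rewrite -/m;
      set sw := \sum_s \sum_t _; lra.
  apply: le_trans (cauchy_schwarz _ _) _.
  have aa : dot (w + M *m w) (w + M *m w) <= m.
    have := @dot_young _ _ 1 w (M *m w) ltr01.
    rewrite !dot_lin (dotC (M *m w) w) invr1; move: ww MwMw; rewrite -/m; lra.
  rewrite vv [m ^+ 3]exprSr -mulrA ler_wpM2l ?sqr_ge0// mulrC.
  apply: le_trans (sqn_mulmx_le _ _) _; by rewrite ler_wpM2l ?sqr_ge0.
have K4 : m <= 4 * opnorm K ^+ 2.
  have m3 : 0 < m ^+ 3 by rewrite exprn_gt0// (lt_le_trans _ m2).
  rewrite -(ler_pM2l m3); move: K2; rewrite [m ^+ 3]exprSr; nra.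
rewrite /bconst -/M -/K -/m expr2 -mulrA ler_wpM2l ?ler0n//.
have := opnorm_ge0 WM; move: K4; lra.
Qed.
End weights.

(** * Graph Laplacians *)

Section graph_laplacian.
Context {R : realType} {p : nat}.
Variable e : rel 'I_p.

(** Taken over an arbitrary relation, so as to cover both the Laplacian of one coalition and the
    block-diagonal one on all agents. *)
Definition graph_laplacian : 'M[R]_p :=
  \matrix_(j, m) ((j == m)%:R * #|[set q | e q j]|%:R - (e m j)%:R).

Lemma graph_laplacianE (v : 'cV[R]_p) j :
  (graph_laplacian *m v) j 0 = \sum_(m | e m j) (v j 0 - v m 0).
Proof.
rewrite mxE sumrB sumr_const.
transitivity (\sum_m ((j == m)%:R * #|[set q | e q j]|%:R * v m 0
                     - (e m j)%:R * v m 0)).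
  by apply: eq_bigr => m _; rewrite mxE mulrBl.
rewrite sumrB; congr (_ - _).
  rewrite (bigD1 j)//= eqxx mul1r big1 ?addr0 => [|m]; last first.
    by rewrite eq_sym => /negPf ->; rewrite !mul0r.
  by rewrite mulr_natl; congr (_ *+ _); apply: eq_card => m; rewrite inE.
rewrite [RHS]big_mkcond; apply: eq_bigr => m _; case: (e m j);
  by rewrite ?mul1r ?mul0r.
Qed.

Hypothesis esym : symmetric e.

Lemma graph_laplacian_sym : graph_laplacian^T = graph_laplacian.
Proof.
apply/matrixP => j m; rewrite !mxE esym eq_sym.
by have [->//|] := eqVneq j m; rewrite !mul0r.
Qed.

Lemma graph_laplacian_form (v : 'cV[R]_p) :
  dot v (graph_laplacian *m v) =
  2^-1 * \sum_j \sum_m (e m j)%:R * (v j 0 - v m 0) ^+ 2.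
Proof.
pose F j m : R := (e m j)%:R * (v j 0 * (v j 0 - v m 0)).
have -> : dot v (graph_laplacian *m v) = \sum_j \sum_m F j m.
  apply: eq_bigr => j _; rewrite graph_laplacianE mulr_sumr big_mkcond.
  by apply: eq_bigr => m _; rewrite /F; case: (e m j); rewrite ?mul1r ?mul0r.
have -> : \sum_j \sum_m (e m j)%:R * (v j 0 - v m 0) ^+ 2 =
    \sum_j \sum_m F j m + \sum_j \sum_m F m j.
  rewrite -big_split; apply: eq_bigr => j _; rewrite -big_split.
  by apply: eq_bigr => m _; rewrite /F (esym j m) /=; ring.
rewrite [X in _ + X]exchange_big /=; lra.
Qed.

Lemma graph_laplacian_psd (v : 'cV[R]_p) : 0 <= dot v (graph_laplacian *m v).
Proof.
rewrite graph_laplacian_form mulr_ge0 ?invr_ge0//.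
by apply: sumr_ge0 => j _; apply: sumr_ge0 => m _; rewrite mulr_ge0 ?sqr_ge0.
Qed.

(** Adding the missing edges only increases the form, and for the complete graph it equals p |v|^2 -
    (sum v)^2. *)
Lemma graph_laplacian_form_le (v : 'cV[R]_p) :
  dot v (graph_laplacian *m v) <= p%:R * dot v v.
Proof.
rewrite graph_laplacian_form.
apply: (@le_trans _ _ (2^-1 * \sum_j \sum_m (v j 0 - v m 0) ^+ 2)).
  rewrite ler_wpM2l ?invr_ge0//; apply: ler_sum => j _; apply: ler_sum => m _.
  by rewrite ler_piMl ?sqr_ge0//; case: (e m j).
have -> : \sum_j \sum_m (v j 0 - v m 0) ^+ 2 =
    2 * (p%:R * dot v v - (\sum_j v j 0) ^+ 2).
  have pv : p%:R * dot v v = \sum_j \sum_(m < p) v j 0 * v j 0.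
    rewrite mulr_sumr; apply: eq_bigr => j _.
    by rewrite sumr_const card_ord mulr_natl.
  have vv : (\sum_j v j 0) ^+ 2 = \sum_j \sum_m v j 0 * v m 0.
    by rewrite expr2 mulr_suml; apply: eq_bigr => j _; rewrite mulr_sumr.
  transitivity (\sum_j (\sum_(m < p) v j 0 * v j 0 +
      \sum_m v m 0 * v m 0 - 2 * \sum_m v j 0 * v m 0)).
    apply: eq_bigr => j _; rewrite mulr_sumr -big_split -sumrB.
    by apply: eq_bigr => m _ /=; ring.
  rewrite sumrB big_split/= -mulr_sumr -vv [X in _ + X - _]exchange_big/= -pv.
  ring.
rewrite mulrA mulVf ?mul1r ?pnatr_eq0// gerBl; exact: sqr_ge0.
Qed.

(** As a form, L lies between 0 and p. With u = L v, positivity at u - p v and the upper bound at u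
    and at v combine to p |u|^2 <= p^3 |v|^2, without any spectral decomposition. *)
Lemma opnorm_graph_laplacian : opnorm graph_laplacian <= p%:R.
Proof.
apply: opnorm_le => [|v]; first exact: ler0n.
have [p0|p0] := ltrP 0 (p%:R : R); last first.
  have := le_trans (sqn_mulmx_frobenius graph_laplacian v).
  have -> : p%:R = 0 :> R by apply/eqP; rewrite eq_le p0 ler0n.
  move: p0; rewrite lern0 => /eqP p0 _.
  rewrite /dot !big1 ?mulr0// => i;
    by move: (ltn_ord i); rewrite [X in (_ < X)%N]p0.
set u := graph_laplacian *m v.
have := graph_laplacian_psd (u - p%:R *: v).
rewrite mulmxBr -scalemxAr !dot_lin.
have -> : dot v (graph_laplacian *m u) = dot u u.
  by rewrite -{1}graph_laplacian_sym -dot_mulmx.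
rewrite -/u.
have := graph_laplacian_form_le u; have := graph_laplacian_form_le v.
rewrite -/u => h1 h2 h3.
have h4 := ler_wpM2l (ltW (mulr_gt0 p0 p0)) h1.
by rewrite -(ler_pM2l p0); move: h2 h3 h4; rewrite expr2; lra.
Qed.

(** Column j contains the degree of j, at least 1, and the entry -1 at m, so its squared norm is at
    least 2. *)
Lemma opnorm_graph_laplacian_edge j m : irreflexive e -> e j m ->
  2 <= opnorm graph_laplacian ^+ 2.
Proof.
move=> eirr ejm.
have jm : j != m by apply/eqP => jm; rewrite jm eirr in ejm.
have := sqn_mulmx_le graph_laplacian (delta_mx j 0).
rewrite dot_delta mxE !eqxx mulr1; apply: le_trans.
have entry i : (graph_laplacian *m delta_mx j 0) i 0 = graph_laplacian i j.
  rewrite mxE (bigD1 j)//= big1 ?addr0 => [|k /negPf kj];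
    rewrite [delta_mx _ _ _ _]mxE.
    by rewrite !eqxx mulr1.
  by rewrite kj mulr0.
rewrite /dot (bigD1 j)//= (bigD1 m) 1?eq_sym//= !entry !mxE eirr eqxx.
rewrite ejm eq_sym (negPf jm) mul0r mul1r sub0r mulrNN mulr1 subr0.
rewrite -[leLHS]/(1 + 1) lerD ?lerDl//.
  have : 1 <= #|[set q | e q j]|%:R :> R.
    by rewrite ler1n; apply/card_gt0P; exists m; rewrite inE esym.
  by set d := #|_|%:R; nra.
by apply: sumr_ge0 => i _; rewrite -expr2 sqr_ge0.
Qed.

(** The quadratic form vanishes at v, hence so does each of its nonnegative terms. *)
Lemma ker_graph_laplacian (v : 'cV[R]_p) : graph_laplacian *m v = 0 ->
  forall j m, e j m -> v j 0 = v m 0.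
Proof.
move=> Lv j m ejm.
have : dot v (graph_laplacian *m v) = 0 by rewrite Lv dot0r.
rewrite graph_laplacian_form => /eqP; rewrite mulf_eq0 invr_eq0 pnatr_eq0/=.
have pos i k : 0 <= (e k i)%:R * (v i 0 - v k 0) ^+ 2.
  by rewrite mulr_ge0 ?sqr_ge0.
rewrite psumr_eq0 => [|i _]; last exact: sumr_ge0.
move=> /allP/(_ m); rewrite mem_index_enum => /(_ isT)/=.
rewrite psumr_eq0// => /allP/(_ j); rewrite mem_index_enum => /(_ isT)/=.
by rewrite ejm mul1r sqrf_eq0 subr_eq0 => /eqP.
Qed.

End graph_laplacian.

(** Since |A x|^2 = x^T A^2 x, the kernels of A and A^2 agree, hence so do their row spaces. The
    matrix B inverts A on its range, which bounds a vector of the range by its image under A. *)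
Lemma symmetric_pinv {R : realType} p (A : 'M[R]_p) : A^T = A ->
  exists B : 'M[R]_p, A = B *m (A *m A).
Proof.
move=> Asym; apply/submxP; rewrite submxE; apply/eqP/matrixP => i j.
have : A *m A *m cokermx (A *m A) = 0 by exact: mulmx_coker.
move: (cokermx _) => C AC.
suff Ac : A *m (C *m delta_mx j 0) = 0 :> 'cV_p.
  have -> : (A *m C) i j = col j (A *m C) i 0 by rewrite [RHS]mxE.
  by rewrite colE -mulmxA Ac !mxE.
by apply: dot_eq0; rewrite dot_mulmx Asym !mulmxA AC mul0mx dot0r.
Qed.
(** * Nash equilibria *)

Section calculus.
Context {R : realType} {m : nat}.
Implicit Types (F : 'cV[R]_m -> R) (x v : 'cV[R]_m).

Lemma derive_ge F x v c : derivable F x v ->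
  (forall h, 0 < h -> h <= 1 -> c <= h^-1 * (F (h *: v + x) - F x)) ->
  c <= 'D_v F x.
Proof.
move=> dF Fc.
have /cvg_dnbhs_at_right cF : ((fun h => h^-1 *: ((F \o shift x) (h *: v) - F x))
    @ (0:R)^' --> 'D_v F x)%classic by exact: dF.
apply: (cvgr_to_ge cF); near=> h; apply: Fc; first by near: h; exact: nbhs_right_gt.
by near: h; exact: nbhs_right_le.
Unshelve. all: by end_near. Qed.

Lemma derive_le F x v c : derivable F x v ->
  (forall h, 0 < h -> h <= 1 -> h^-1 * (F (h *: v + x) - F x) <= c) ->
  'D_v F x <= c.
Proof.
move=> dF Fc.
have /cvg_dnbhs_at_right cF : ((fun h => h^-1 *: ((F \o shift x) (h *: v) - F x))
    @ (0:R)^' --> 'D_v F x)%classic by exact: dF.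
apply: (cvgr_to_le cF); near=> h; apply: Fc; first by near: h; exact: nbhs_right_gt.
by near: h; exact: nbhs_right_le.
Unshelve. all: by end_near. Qed.

(** By convexity every secant slope over a step h in (0, 1] is at most F y - F x; pass to the limit
    from the right. *)
Lemma convex_tangent F x y : convex_function [set: 'cV[R]_m] F ->
  derivable F x (y - x) -> 'D_(y - x) F x <= F y - F x.
Proof.
move=> cF dF; apply: derive_le => // h h0 h1.
rewrite ler_pdivrMl//.
have := cF (Itv01 (ltW h0) h1) y x; rewrite !inE => /(_ Logic.I Logic.I).
have -> : h *: (y - x) + x =
    conv (Itv01 (ltW h0) h1) (y : convex_lmodType _) (x : convex_lmodType _).
  rewrite [RHS](_ : _ = h *: y + (1 - h) *: x)//.
  by rewrite scalerBr scalerBl scale1r addrAC addrA addrAC.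
move=> /le_trans; rewrite lerBlDr; apply.
by rewrite convRE /= /unstable.onem; lra.
Qed.

Lemma derive_grad F x v : differentiable F x -> 'D_v F x = dot v (grad F x).
Proof.
move=> dF; rewrite deriveE//.
rewrite [in LHS](matrix_sum_delta v).
under eq_bigr do rewrite big_ord1.
rewrite linear_sum; apply: eq_bigr => i _.
by rewrite linearZ/= mxE /partial deriveE.
Qed.

Lemma derive_eq0_min F x v : differentiable F x ->
  (forall h, F x <= F (h *: v + x)) -> 'D_v F x = 0.
Proof.
move=> dF Fx.
have ge0 w : (forall h, F x <= F (h *: w + x)) -> 0 <= 'D_w F x.
  move=> Fw; apply: derive_ge => [|h h0 h1]; first exact: diff_derivable.
  by apply: mulr_ge0; rewrite ?subr_ge0 ?invr_ge0 ?(ltW h0).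
apply/eqP; rewrite eq_le ge0// andbT -oppr_ge0.
rewrite derive_grad// -dotNl -derive_grad//; apply: ge0 => h.
by rewrite scalerN -scaleNr.
Qed.

(** Works on difference quotients, so the two functions and the two base points may differ and no
    differentiability is assumed. *)
Lemma eq_partial F G (s : 'I_m) x y :
  (forall h, F (h *: delta_mx s 0 + x) - F x = G (h *: delta_mx s 0 + y) - G y) ->
  partial F s x = partial G s y.
Proof.
move=> FG; rewrite /partial /derive.
suff -> : (fun h : R => h^-1 *: ((F \o shift x) (h *: delta_mx s 0) - F x)) =
  (fun h : R => h^-1 *: ((G \o shift y) (h *: delta_mx s 0) - G y)) by [].
by apply/funext => h /=; rewrite FG.
Qed.

End calculus.

Section coalitions.
Context {N : nat} {n : 'I_N -> nat}.

Lemma sum_coalition (R : nmodType) (i : 'I_N) (F : agent n -> R) :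
  \sum_(s | tagnat.sig1 s == i) F s = \sum_(j < n i) F (tagnat.Rank i j).
Proof.
pose G s := if tagnat.sig1 s == i then F s else 0.
rewrite big_mkcond -[LHS]/(\sum_s G s).
rewrite (reindex (fun p => tagnat.rank p)); last exact: tagnat.rank_bij_on.
transitivity (\sum_k \sum_(j < n k) G (tagnat.Rank k j)).
  by rewrite sig_big_dep; apply: eq_bigr => -[].
rewrite (bigD1 i)//= [X in _ + X]big1 ?addr0 => [|k ki]; last first.
  by rewrite big1// => j _; rewrite /G tagnat.Rank1K (negPf ki).
by apply: eq_bigr => j _; rewrite /G tagnat.Rank1K eqxx.
Qed.

Lemma sum_by_coalition (R : nmodType) (F : agent n -> R) :
  \sum_s F s = \sum_i \sum_(s | tagnat.sig1 s == i) F s.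
Proof. by rewrite (partition_big (fun s => tagnat.sig1 s) predT). Qed.

Lemma submxcolE (R : Type) (x : 'cV[R]_(nsum n)) i j :
  submxcol x i j 0 = x (tagnat.Rank i j) 0.
Proof. by rewrite mxE. Qed.

End coalitions.

(** * First-order characterization and uniqueness of the Nash equilibrium *)

Section equilibrium.
Context {R : realType} {N : nat} {n : 'I_N -> nat}.
Variables (f : agent n -> 'cV[R]_(nsum n) -> R) (r : 'cV[R]_(nsum n)).
Variables (l : agent n -> R) (mu : R).
Hypothesis special : special_game f.
Hypothesis smooth : smooth_convex f l.
Hypothesis monotone : strongly_monotone_game f mu.

Let diff s x : differentiable (f s) x.
Proof. by case: (smooth s) => _ + _ _; apply. Qed.

Lemma special_partial s (y z : 'cV[R]_(nsum n)) : y s 0 = z s 0 ->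
  (forall t, tagnat.sig1 t != tagnat.sig1 s -> y t 0 = z t 0) ->
  partial (f s) s y = partial (f s) s z.
Proof.
move=> yzs yz; apply: eq_partial => h; rewrite (special yzs yz); congr (_ - _).
apply: special => [|t ts]; first by rewrite !mxE yzs.
by rewrite mxE [RHS]mxE yz.
Qed.

Lemma special_partial0 s t x : tagnat.sig1 t = tagnat.sig1 s -> t != s ->
  partial (f t) s x = 0.
Proof.
move=> ts tns.
rewrite -[RHS](_ : partial (cst 0 : _ -> R) s x = 0); last exact: derive_cst.
apply: eq_partial => h; rewrite /cst subrr; apply/eqP; rewrite subr_eq0; apply/eqP.
apply: special => [|u us]; rewrite mxE [X in X + _]mxE [delta_mx _ _ _ _]mxE.
  by rewrite (negPf tns) mulr0 add0r.
by rewrite [u == s](_ : _ = false) ?mulr0 ?add0r//; apply/eqP => us';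
  rewrite us' ts eqxx in us.
Qed.

Let coalition_objectiveE i :
  coalition_objective f i = \sum_(j < n i) f (tagnat.Rank i j).
Proof. by apply/funext => x; rewrite fct_sumE. Qed.

Lemma differentiable_coalition_objective i x :
  differentiable (coalition_objective f i) x.
Proof. by rewrite coalition_objectiveE; exact: differentiable_sum. Qed.

(** In the special game the objectives of the other members of the coalition of s are insensitive to
    x_s, so a single term of the coalition sum survives. *)
Lemma pseudo_gradientE x s : pseudo_gradient f x s 0 = partial (f s) s x.
Proof.
rewrite -(tagnat.sig2K s); move: (tagnat.sig1 s) (tagnat.sig2 s) => i j.
rewrite -submxcolE mxcolK submxcolE mxE /partial coalition_objectiveE.
rewrite derive_sum => [|k]; last exact: diff_derivable.
rewrite (bigD1 j)//= [X in _ + X]big1 ?addr0// => k kj.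
rewrite -/(partial _ _ _) special_partial0 ?tagnat.Rank1K//.
by rewrite -val_eqE/= tagnat.eq_Rank eqxx.
Qed.

Lemma grad_coalition_objective x s :
  grad (coalition_objective f (tagnat.sig1 s)) x s 0 = pseudo_gradient f x s 0.
Proof.
rewrite -(tagnat.sig2K s); move: (tagnat.sig1 s) (tagnat.sig2 s) => i j.
by rewrite tagnat.Rank1K -[RHS]submxcolE mxcolK submxcolE.
Qed.

Lemma partial_lipschitz s y z :
  (partial (f s) s y - partial (f s) s z) ^+ 2 <= l s ^+ 2 * dot (y - z) (y - z).
Proof.
case: (smooth s) => _ _ _ /(_ y z) lip.
have := sqr_le_dot (grad (f s) y - grad (f s) z) s.
rewrite !mxE => /le_trans; apply; rewrite -!l2norm_sq -exprMn.
by rewrite ler_sqr// nnegrE ?l2norm_ge0// (le_trans _ lip)// l2norm_ge0.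
Qed.

(** Test strong monotonicity on the basis vector of s and 0: the increment of the s-th partial
    derivative is at least mu and at most the Lipschitz constant. *)
Lemma mono_const_le_lipschitz s : mu <= l s.
Proof.
case: monotone => mu0 /(_ (delta_mx s 0) 0).
rewrite subr0 l2norm_sq dot_delta mxE !eqxx mulr1 dotE dot_delta mxE.
rewrite [X in _ + X]mxE !pseudo_gradientE => h.
case: (smooth s) => _ _ _ /(_ (delta_mx s 0) 0); rewrite subr0.
rewrite [l2norm (delta_mx _ _)]l2normE dot_delta mxE !eqxx sqrtr1 mulr1.
apply: le_trans; apply: le_trans h _.
apply: le_trans (ler_norm _) _; rewrite -ler_sqr ?nnegrE ?l2norm_ge0//.
rewrite l2norm_sq real_normK ?num_real//.
by have := sqr_le_dot (grad (f s) (delta_mx s 0) - grad (f s) 0) s; rewrite !mxE.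
Qed.

(** The stationarity condition under the resource constraints; the common value in a coalition is
    the Lagrange multiplier of its constraint. *)
Definition equal_marginals (x : 'cV[R]_(nsum n)) : Prop :=
  forall s t, tagnat.sig1 s = tagnat.sig1 t ->
    pseudo_gradient f x s 0 = pseudo_gradient f x t 0.

Lemma feasible_submxcol (x : 'cV[R]_(nsum n)) i :
  feasible r (submxcol x i) <-> \sum_(s | tagnat.sig1 s == i) (x - r) s 0 = 0.
Proof.
rewrite sum_coalition (eq_bigr (fun j =>
  x (tagnat.Rank i j) 0 - r (tagnat.Rank i j) 0)) => [|j _]; last by rewrite !mxE.
rewrite sumrB /feasible /coalition_resource /=.
rewrite (eq_bigr (fun j => x (tagnat.Rank i j) 0)) => [|j _]; last exact: submxcolE.
by split => [->|/eqP]; rewrite ?subrr// subr_eq0 => /eqP.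
Qed.

Lemma dot_equal_marginals (x v : 'cV[R]_(nsum n)) : equal_marginals x ->
  (forall i, \sum_(s | tagnat.sig1 s == i) v s 0 = 0) ->
  dot v (pseudo_gradient f x) = 0.
Proof.
move=> eqx v0; rewrite /dot sum_by_coalition big1// => i _.
have [s /eqP si|none] := pickP (fun s : agent n => tagnat.sig1 s == i).
  rewrite (eq_bigr (fun t => v t 0 * pseudo_gradient f x s 0)).
    by rewrite -mulr_suml v0 mul0r.
  by move=> t /eqP ti; congr (_ * _); apply: eqx; rewrite ti si.
by apply: big1 => s; rewrite none.
Qed.

(** The content is that the difference vanishes outside coalition i; this form serves as a rewriting
    rule. *)
Lemma replace_blockE (x : 'cV[R]_(nsum n)) i (y : 'cV[R]_(n i)) s :
  (replace_block x y - x) s 0 =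
  if tagnat.sig1 s == i then (replace_block x y - x) s 0 else 0.
Proof.
case: ifPn => // si; rewrite mxE [X in _ + X]mxE.
rewrite -(tagnat.sig2K s); move: (tagnat.sig1 s) (tagnat.sig2 s) si => k j ki.
by rewrite -!submxcolE mxcolK dfwithout 1?eq_sym// subrr.
Qed.

Lemma replace_block_submxcol (x z : 'cV[R]_(nsum n)) i :
  (forall s, tagnat.sig1 s != i -> z s 0 = x s 0) ->
  replace_block x (submxcol z i) = z.
Proof.
move=> zx; apply/matrixP => s c; rewrite {c}ord1.
have := zx s; rewrite -(tagnat.sig2K s).
move: (tagnat.sig1 s) (tagnat.sig2 s) => k j; rewrite tagnat.Rank1K => {}zx.
rewrite -[LHS]submxcolE mxcolK; have [ki|ki] := eqVneq k i.
  by case: _ / ki in zx *; rewrite dfwithin submxcolE.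
by rewrite dfwithout 1?eq_sym// submxcolE zx.
Qed.

(** Moving resource from t to s within a coalition stays feasible in both directions, so the
    derivative along the difference of their basis vectors is zero. *)
Lemma NE_equal_marginals x : is_NE f r x -> equal_marginals x.
Proof.
move=> [xr xNE] s t st; set i := tagnat.sig1 s.
pose v : 'cV[R]_(nsum n) := delta_mx s 0 - delta_mx t 0.
have : 'D_v (coalition_objective f i) x = 0.
  apply: derive_eq0_min; first exact: differentiable_coalition_objective.
  move=> h; have := xNE i (submxcol (h *: v + x) i).
  rewrite replace_block_submxcol => [|u ui]; last first.
    have us : (u == s) = false by apply/eqP => E; rewrite E eqxx in ui.
    have ut : (u == t) = false by apply/eqP => E; rewrite E -st eqxx in ui.
    by rewrite !mxE us ut subrr mulr0 add0r.
  apply; apply/feasible_submxcol.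
  move/feasible_submxcol: (xr i) => xri.
  have sum_delta u : tagnat.sig1 u = i ->
      \sum_(k | tagnat.sig1 k == i) (delta_mx u 0 : 'cV[R]_(nsum n)) k 0 = 1.
    move=> ui; rewrite (bigD1 u) ?ui//= mxE !eqxx [X in _ + X]big1 ?addr0//.
    by move=> k /andP[_ /negPf ku]; rewrite mxE ku.
  transitivity (h *
     (\sum_(k | tagnat.sig1 k == i) (delta_mx s 0 : 'cV[R]_(nsum n)) k 0
     - \sum_(k | tagnat.sig1 k == i) (delta_mx t 0 : 'cV[R]_(nsum n)) k 0)
     + \sum_(k | tagnat.sig1 k == i) (x - r) k 0).
    rewrite -sumrB mulr_sumr -big_split; apply: eq_bigr => k _ /=.
    by rewrite !mxE; ring.
  by rewrite xri !sum_delta// subrr mulr0 addr0.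
rewrite derive_grad; last exact: differentiable_coalition_objective.
rewrite dotBl !dot_delta grad_coalition_objective /i st grad_coalition_objective.
by move=> /eqP; rewrite subr_eq0 => /eqP.
Qed.

(** A feasible deviation z of coalition i changes only block i, where the gradient of its objective
    coincides with the pseudo-gradient. The derivative along z - x is therefore 0, and convexity
    concludes. *)
Lemma equal_marginals_NE x : (forall i, feasible r (submxcol x i)) ->
  equal_marginals x -> is_NE f r x.
Proof.
move=> xr eqx; split => // i y yr.
set z := replace_block x y.
have zx0 k : \sum_(s | tagnat.sig1 s == k) (z - x) s 0 = 0.
  have [->|ki] := eqVneq k i; last first.
    by rewrite big1// => s /eqP sk; rewrite replace_blockE sk (negPf ki).
  rewrite sum_coalition.
  have := yr; have := xr i; rewrite /feasible /= => xri {}yr.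
  transitivity (\sum_j y j 0 - \sum_j submxcol x i j 0); last first.
    by rewrite xri yr subrr.
  rewrite -sumrB; apply: eq_bigr => j _; rewrite mxE [X in _ + X]mxE.
  by rewrite -!submxcolE mxcolK dfwithin.
rewrite -subr_ge0 -sumrB.
apply: (@le_trans _ _ ('D_(z - x) (coalition_objective f i) x)).
  rewrite derive_grad; last exact: differentiable_coalition_objective.
  rewrite -(dot_equal_marginals eqx zx0) le_eqVlt; apply/orP/or_introl/eqP.
  apply: eq_bigr => s _.
  have [si|si] := eqVneq (tagnat.sig1 s) i.
    by rewrite -grad_coalition_objective si.
  by rewrite replace_blockE (negPf si) !mul0r.
rewrite coalition_objectiveE derive_sum => [|j]; last exact: diff_derivable.
apply: ler_sum => j _; apply: convex_tangent; last exact: diff_derivable.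
by case: (smooth (tagnat.Rank i j)).
Qed.

(** The difference x - y has zero sum on each coalition, so it is orthogonal to both
    pseudo-gradients, and strong monotonicity makes it vanish. *)
Lemma NE_unique x y : is_NE f r x -> is_NE f r y -> x = y.
Proof.
move=> xNE yNE; case: monotone => mu0 /(_ x y).
have xy0 i : \sum_(s | tagnat.sig1 s == i) (x - y) s 0 = 0.
  case: xNE => /(_ i)/feasible_submxcol + _.
  case: yNE => /(_ i)/feasible_submxcol + _.
  move=> yr xr; transitivity (\sum_(s | tagnat.sig1 s == i) (x - r) s 0
    - \sum_(s | tagnat.sig1 s == i) (y - r) s 0); last by rewrite xr yr subrr.
  by rewrite -sumrB; apply: eq_bigr => s _; rewrite !mxE; ring.
rewrite dotE dotBr (dot_equal_marginals (NE_equal_marginals xNE) xy0).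
rewrite (dot_equal_marginals (NE_equal_marginals yNE) xy0) subrr l2norm_sq.
rewrite pmulr_rle0// => xy; apply/eqP; rewrite -subr_eq0; apply/eqP.
by apply: dot_eq0; apply/eqP; rewrite eq_le xy dot_ge0.
Qed.

End equilibrium.

(** * The Laplacian of the coalitions *)

Section coalition_laplacian.
Context {R : realType} {N : nat} {n : 'I_N -> nat}.
Variable E : rel (agent n).
Hypothesis netE : connected_network E.

Definition same_coalition_edge : rel (agent n) :=
  fun s t => E s t && (tagnat.sig1 s == tagnat.sig1 t).

Definition coalition_laplacian : 'M[R]_(nsum n) :=
  graph_laplacian same_coalition_edge.

Local Notation L := coalition_laplacian.

Let edge_sym : symmetric same_coalition_edge.
Proof.
by case: netE => _ Esym _ _ s t; rewrite /same_coalition_edge Esym eq_sym.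
Qed.

Lemma coalition_laplacianE (v : 'cV[R]_(nsum n)) s :
  (L *m v) s 0 = \sum_(t in coalition_neighbors E s) (v s 0 - v t 0).
Proof.
rewrite graph_laplacianE; apply: eq_bigl => t.
by rewrite edge_sym !inE.
Qed.

Lemma coalition_laplacian_sym : L^T = L.
Proof. exact: graph_laplacian_sym. Qed.

Lemma dot_coalition_laplacian u v : dot (L *m u) v = dot u (L *m v).
Proof. by rewrite dot_mulmx coalition_laplacian_sym. Qed.

(** The indicator of a coalition lies in the kernel of the symmetric matrix L. This is what
    preserves the resource constraints at every iteration. *)
Lemma sum_coalition_laplacian (v : 'cV[R]_(nsum n)) i :
  \sum_(s | tagnat.sig1 s == i) (L *m v) s 0 = 0.
Proof.
pose c : 'cV[R]_(nsum n) := \col_s (tagnat.sig1 s == i)%:R.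
transitivity (dot c (L *m v)).
  rewrite big_mkcond; apply: eq_bigr => s _; rewrite [c _ _]mxE.
  by case: ifP; rewrite ?mul1r ?mul0r.
rewrite -dot_coalition_laplacian (_ : L *m c = 0) ?dot0l//.
apply/matrixP => s k; rewrite {k}ord1 graph_laplacianE [RHS]mxE.
apply: big1 => t /andP[_ /eqP st]; by rewrite !mxE st subrr.
Qed.

Lemma laplacianE i : laplacian R E i = graph_laplacian (Defs.induced E (i := i)).
Proof.
apply/matrixP => j m; rewrite /laplacian !mxE; congr (_ * _%:R - _).
(* The degree counts a classical set on one side and a finite set on the other. *)
by apply: eq_card => q; rewrite [RHS]inE; apply/idP/idP; rewrite in_setE.
Qed.

Lemma submxcol_coalition_laplacian (v : 'cV[R]_(nsum n)) i :
  submxcol (L *m v) i = laplacian R E i *m submxcol v i.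
Proof.
apply/matrixP => j k; rewrite {k}ord1 submxcolE.
rewrite laplacianE !graph_laplacianE.
transitivity (\sum_(t | tagnat.sig1 t == i)
   (if E t (tagnat.Rank i j) then v (tagnat.Rank i j) 0 - v t 0 else 0)).
  rewrite -big_mkcondr; apply: eq_bigl => t.
  by rewrite /same_coalition_edge tagnat.Rank1K andbC.
rewrite sum_coalition [RHS]big_mkcond; apply: eq_bigr => m _.
by rewrite !submxcolE.
Qed.

Definition block_sqn i (v : 'cV[R]_(nsum n)) : R :=
  \sum_(s | tagnat.sig1 s == i) v s 0 ^+ 2.

Lemma block_sqnE i v : block_sqn i v = dot (submxcol v i) (submxcol v i).
Proof.
rewrite /block_sqn sum_coalition; apply: eq_bigr => j _.
by rewrite !submxcolE expr2.
Qed.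

Lemma sum_block_sqn v : \sum_i block_sqn i v = dot v v.
Proof.
rewrite /block_sqn -(sum_by_coalition (fun s => v s 0 ^+ 2)).
by apply: eq_bigr => s _; rewrite expr2.
Qed.

Lemma block_sqn_laplacian_le i v :
  block_sqn i (L *m v) <= opnorm (laplacian R E i) ^+ 2 * block_sqn i v.
Proof. by rewrite !block_sqnE submxcol_coalition_laplacian sqn_mulmx_le. Qed.

Lemma block_sqnD_le i u v :
  block_sqn i (u + v) <= 2 * (block_sqn i u + block_sqn i v).
Proof.
rewrite mulrDr !mulr_sumr -big_split; apply: ler_sum => s _ /=; rewrite mxE.
have := sqr_ge0 (u s 0 - v s 0); lra.
Qed.

Let induced_sym i : symmetric (Defs.induced E (i := i)).
Proof. by case: netE => _ _ _ /(_ i)[]. Qed.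

Lemma laplacian_dichotomy i :
  2 <= opnorm (laplacian R E i) ^+ 2 \/ laplacian R E i = 0.
Proof.
have [/existsP[j /existsP[m jm]]|/existsPn none] :=
    boolP [exists j, exists m, Defs.induced E (i := i) j m].
  left; rewrite laplacianE.
  apply: (@opnorm_graph_laplacian_edge _ _ _ _ j m) => // k.
  by case: netE => Eirr _ _ _; exact: Eirr.
right; have {}none j m : Defs.induced E (i := i) m j = false.
  by apply/negbTE; rewrite induced_sym; have /existsPn := none j; apply.
rewrite laplacianE; apply/matrixP => j m; rewrite !mxE none subr0.
by rewrite eq_card0 ?mulr0// => q; rewrite inE none.
Qed.

Lemma opnorm_laplacian_le i : opnorm (laplacian R E i) <= (n i)%:R.
Proof. by rewrite laplacianE; exact: opnorm_graph_laplacian. Qed.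

(** Values agree along the edges inside a coalition, hence on the whole coalition because its
    induced graph is connected. *)
Lemma ker_coalition_laplacian (v : 'cV[R]_(nsum n)) : L *m v = 0 ->
  forall s t, tagnat.sig1 s = tagnat.sig1 t -> v s 0 = v t 0.
Proof.
move=> Lv s t st.
have const i (j m : 'I_(n i)) : v (tagnat.Rank i j) 0 = v (tagnat.Rank i m) 0.
  have jm : connect (Defs.induced E (i := i)) j m.
    by case: netE => _ _ _ /(_ i)[_]; apply.
  pose a := [pred k : 'I_(n i) | v (tagnat.Rank i k) 0 == v (tagnat.Rank i m) 0].
  have ac : closed_mem (Defs.induced E (i := i)) (mem a).
    move=> k k' kk'; rewrite !inE; congr (_ == _).
    apply: (ker_graph_laplacian edge_sym Lv).
    by rewrite /same_coalition_edge !tagnat.Rank1K eqxx andbT.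
  by have := closed_connect ac jm; rewrite !inE eqxx => /eqP.
rewrite -(tagnat.sig2K s) -(tagnat.sig2K t).
by move: (tagnat.sig2 s); rewrite st => j; exact: const.
Qed.

(** * Growth of gradient differences under the Laplacian *)

Section growth.
Variable l : agent n -> R.
Hypothesis l0 : forall s, 0 <= l s.

Local Notation Lam i := (opnorm (laplacian R E i)).
Local Notation li i := (coalition_lipschitz l i).
Let A i := li i ^+ 2 * Lam i ^+ 2.
Let m2 := \big[Num.max/0]_i A i.
Let m4 := \big[Num.max/0]_i (li i ^+ 2 * Lam i ^+ 4).

Let A0 i : 0 <= A i. Proof. by rewrite mulr_ge0 ?sqr_ge0. Qed.

Let m2_ge0 : 0 <= m2. Proof. exact: bigmax_ge_id. Qed.

Lemma lipschitz_le_coalition s : l s <= li (tagnat.sig1 s).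
Proof.
rewrite /coalition_lipschitz -sum_coalition (bigD1 s)//= lerDl.
exact: sumr_ge0.
Qed.

Lemma block_sqn_lipschitz_le i (u : 'cV[R]_(nsum n)) (c : agent n -> R) :
  (forall s, 0 <= c s) -> (forall s, u s 0 ^+ 2 <= l s ^+ 2 * c s) ->
  block_sqn i u <= li i ^+ 2 * \sum_(s | tagnat.sig1 s == i) c s.
Proof.
move=> c0 uc; rewrite /block_sqn mulr_sumr; apply: ler_sum => s /eqP si.
apply: le_trans (uc s) _; rewrite ler_wpM2r// ler_sqr ?nnegrE//.
  by rewrite -si lipschitz_le_coalition.
by apply: sumr_ge0.
Qed.

(** Here all agents share one bound c, counted only once per coalition because the sum of the l_s^2
    is at most (sum l_s)^2. *)
Lemma block_sqn_lipschitz_le_const i (u : 'cV[R]_(nsum n)) (c : R) :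
  0 <= c -> (forall s, u s 0 ^+ 2 <= l s ^+ 2 * c) ->
  block_sqn i u <= li i ^+ 2 * c.
Proof.
move=> c0 uc; apply: (@le_trans _ _ ((\sum_(s | tagnat.sig1 s == i) l s ^+ 2) * c)).
  by rewrite mulr_suml; apply: ler_sum => s _; exact: uc.
rewrite ler_wpM2r//; set b := li i.
have b0 : 0 <= b by apply: sumr_ge0.
have bE : b = \sum_(s | tagnat.sig1 s == i) l s by rewrite sum_coalition.
rewrite [leRHS]expr2 {1}bE mulr_suml.
apply: ler_sum => s /eqP si; rewrite expr2 ler_wpM2l//.
by rewrite /b -si lipschitz_le_coalition.
Qed.

Section perturbation.
(** In the application p = P x - P xs, u is the gradient error due to the estimates, D = |x - xs|^2,
    and e i is the squared estimation error of coalition i. *)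
Variables (p u : 'cV[R]_(nsum n)) (D : R) (e : 'I_N -> R).
Hypothesis D0 : 0 <= D.
Hypothesis e0 : forall i, 0 <= e i.
Hypothesis pD : forall i, block_sqn i p <= li i ^+ 2 * D.
Hypothesis ue : forall i, block_sqn i u <= li i ^+ 2 * e i.

Lemma sqn_laplacian_le : dot (L *m (p + u)) (L *m (p + u)) <=
  2 * ((\sum_i A i) * D + m2 * \sum_i e i).
Proof.
rewrite -sum_block_sqn mulr_suml mulr_sumr -big_split mulr_sumr.
apply: ler_sum => i _ /=; apply: le_trans (block_sqn_laplacian_le _ _) _.
apply: (@le_trans _ _ (Lam i ^+ 2 * (2 * (li i ^+ 2 * D + li i ^+ 2 * e i)))).
  rewrite ler_wpM2l ?sqr_ge0//; apply: le_trans (block_sqnD_le _ _ _) _.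
  by rewrite ler_wpM2l// lerD.
apply: (@le_trans _ _ (2 * (A i * D + A i * e i))).
  by rewrite /A le_eqVlt; apply/orP; left; apply/eqP; ring.
by rewrite ler_wpM2l// lerD2l ler_wpM2r//; exact: le_bigmax.
Qed.

Lemma sqn_laplacian2_le : dot (L *m (L *m (p + u))) (L *m (L *m (p + u))) <=
  2 * ((\sum_i li i ^+ 2 * Lam i ^+ 4) * D + m4 * \sum_i e i).
Proof.
rewrite -sum_block_sqn mulr_suml mulr_sumr -big_split mulr_sumr.
apply: ler_sum => i _ /=; apply: le_trans (block_sqn_laplacian_le _ _) _.
apply: (@le_trans _ _ (Lam i ^+ 2 *
    (Lam i ^+ 2 * (2 * (li i ^+ 2 * D + li i ^+ 2 * e i))))).
  rewrite ler_wpM2l ?sqr_ge0//; apply: le_trans (block_sqn_laplacian_le _ _) _.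
  rewrite ler_wpM2l ?sqr_ge0//; apply: le_trans (block_sqnD_le _ _ _) _.
  by rewrite ler_wpM2l// lerD.
apply: (@le_trans _ _ (2 * (li i ^+ 2 * Lam i ^+ 4 * D
                             + li i ^+ 2 * Lam i ^+ 4 * e i))).
  by rewrite le_eqVlt; apply/orP; left; apply/eqP; ring.
rewrite ler_wpM2l// lerD2l ler_wpM2r//.
exact: (le_bigmax _ (fun i => li i ^+ 2 * Lam i ^+ 4)).
Qed.

(* Coalitions without edges do not move, and in the others [2 <= |L_i|^2]. *)
Lemma dot_laplacian_perturbation_le mu (z : 'cV[R]_(nsum n)) : 0 < mu ->
  2 * dot (L *m z) u <=
  2^-1 * mu * dot (L *m z) (L *m z) + mu^-1 * (m2 * \sum_i e i).
Proof.
move=> mu0; rewrite -sum_block_sqn.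
have -> : 2 * dot (L *m z) u =
    \sum_i 2 * \sum_(s | tagnat.sig1 s == i) (L *m z) s 0 * u s 0.
  by rewrite -mulr_sumr -sum_by_coalition.
rewrite !mulr_sumr -big_split; apply: ler_sum => i _ /=.
have rhs0 : 0 <= mu^-1 * (m2 * e i) by rewrite !mulr_ge0// invr_ge0 ltW.
case: (laplacian_dichotomy i) => [Lam2|Li0]; last first.
  have Lz0 : block_sqn i (L *m z) = 0.
    by rewrite block_sqnE submxcol_coalition_laplacian Li0 mul0mx dot0l.
  rewrite Lz0 mulr0 add0r big1 ?mulr0// => s /eqP si.
  suff -> : (L *m z) s 0 = 0 by rewrite mul0r.
  apply/eqP; rewrite -sqrf_eq0 eq_le sqr_ge0 andbT -Lz0 /block_sqn.
  rewrite (bigD1 s) ?si//= lerDl; apply: sumr_ge0 => t _; exact: sqr_ge0.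
(* Young's inequality with weight mu / 2 leaves the factor 2 / mu on |u|^2. *)
apply: (@le_trans _ _ (2^-1 * mu * block_sqn i (L *m z)
    + 2 * mu^-1 * block_sqn i u)).
  rewrite !mulr_sumr -big_split; apply: ler_sum => s _ /=.
  set a := (L *m z) s 0; set b := u s 0.
  have := mulr_ge0 (ltW mu0) (sqr_ge0 (2^-1 * a - mu^-1 * b)).
  have -> : mu * (2^-1 * a - mu^-1 * b) ^+ 2 =
      4^-1 * mu * a ^+ 2 - a * b + mu^-1 * b ^+ 2 by field; lra.
  have -> : 2^-1 * mu * a ^+ 2 + 2 * mu^-1 * b ^+ 2 =
    2 * (4^-1 * mu * a ^+ 2 + mu^-1 * b ^+ 2) by field; lra.
  lra.
rewrite lerD2l [2 * _]mulrC -mulrA ler_wpM2l ?invr_ge0 ?(ltW mu0)//.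
have Ai : A i * e i <= m2 * e i by rewrite ler_wpM2r//; exact: le_bigmax.
apply: le_trans Ai.
(* The surplus factor 2 is absorbed by 2 <= |L_i|^2. *)
have hi : li i ^+ 2 * e i * 2 <= A i * e i.
  by rewrite /A mulrAC ler_wpM2r// ler_wpM2l// sqr_ge0.
apply: le_trans hi; rewrite mulrC ler_wpM2r//; exact: ue.
Qed.

End perturbation.

Lemma sum_lipschitz_laplacian4_le :
  \sum_i li i ^+ 2 * Lam i ^+ 4 <= m2 * (nsum n)%:R ^+ 2.
Proof.
have nn : \sum_i ((n i)%:R ^+ 2 : R) <= (nsum n)%:R ^+ 2.
  rewrite [leRHS]expr2 [X in X * _]natr_sum mulr_suml; apply: ler_sum => i _.
  by rewrite expr2 ler_wpM2l// ler_nat (bigD1 i)//= leq_addr.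
apply: le_trans (ler_wpM2l m2_ge0 nn).
rewrite mulr_sumr; apply: ler_sum => i _.
rewrite (_ : li i ^+ 2 * Lam i ^+ 4 = A i * Lam i ^+ 2); last by rewrite /A; ring.
apply: ler_pM => //; first exact: sqr_ge0; first exact: (le_bigmax _ A).
by rewrite ler_sqr ?nnegrE ?opnorm_ge0// opnorm_laplacian_le.
Qed.

End growth.

End coalition_laplacian.
(** * Linear convergence *)

Section geometric.
Context {R : realType}.

(** The hypotheses give (C + eps) V(k+1) <= C V(k). The ratio C / (C + eps), rather than 1 - eps /
    C, is in (0, 1) without comparing eps and C. *)
Lemma geometric_decay (V Q : nat -> R) (eps C : R) : 0 < eps -> 0 < C ->
  (forall k, 0 <= V k) -> (forall k, V k <= C * Q k) ->
  (forall k, V k.+1 <= V k - eps * Q k) ->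
  exists2 rho, 0 < rho < 1 & forall k, V k <= V 0%N * rho ^+ k.
Proof.
move=> eps0 C0 V0 VQ dV; have Ce0 : 0 < C + eps by exact: addr_gt0.
exists (C / (C + eps)).
  by rewrite divr_gt0//= ltr_pdivrMr// mul1r ltrDl.
elim=> [|k IH]; first by rewrite mulr1.
rewrite exprSr mulrA; apply: le_trans (ler_wpM2r _ IH); last first.
  by rewrite ltW// divr_gt0.
rewrite mulrA ler_pdivlMr//.
have := dV k; have := VQ k; have := V0 k; have Vk1 := V0 k.+1.
set v := V k; set q := Q k; set w := V k.+1 in Vk1 *; move=> v0 vCq wv.
have h1 := ler_wpM2l (ltW Ce0) wv.
have h2 := ler_wpM2l (ltW eps0) vCq.
have h3 : 0 <= q by rewrite -(pmulr_rge0 _ C0) (le_trans v0).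
have h4 : 0 <= eps * (eps * q) by rewrite !mulr_ge0// ltW.
nra.
Qed.

(** With K k the tail of the geometric series, the intervals from u k - K k to u k + K k are nested;
    the limit is the supremum of the left endpoints. *)
Lemma geometric_limit (u : nat -> R) (c q : R) : 0 <= c -> 0 < q < 1 ->
  (forall k, `|u k.+1 - u k| <= c * q ^+ k) ->
  exists y, forall k, `|u k - y| <= c / (1 - q) * q ^+ k.
Proof.
move=> c0 /andP[q0 q1] uc; have q1' : 0 < 1 - q by rewrite subr_gt0.
pose K k := c / (1 - q) * q ^+ k.
have K0 k : 0 <= K k by rewrite !mulr_ge0// ?invr_ge0 ?exprn_ge0// ltW.
have KS k : K k - K k.+1 = c * q ^+ k.
  by rewrite /K exprS; field; rewrite gt_eqF.
have lo k j : u k - K k <= u (k + j)%N - K (k + j)%N.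
  elim: j => [|j IH]; first by rewrite addn0.
  apply: le_trans IH _; rewrite addnS; have := uc (k + j)%N; rewrite -KS.
  by rewrite ler_norml => /andP[h _]; lra.
have hi k j : u (k + j)%N + K (k + j)%N <= u k + K k.
  elim: j => [|j IH]; first by rewrite addn0.
  apply: le_trans IH; rewrite addnS; have := uc (k + j)%N; rewrite -KS.
  by rewrite ler_norml => /andP[_ h]; lra.
have lohi k j : u k - K k <= u j + K j.
  apply: le_trans (lo k j) _; rewrite addnC; apply: le_trans (hi j k).
  by have := K0 (j + k)%N; lra.
pose A := range (fun k => u k - K k).
have A0 : (A !=set0)%classic by exists (u 0%N - K 0%N); exists 0%N.
exists (sup A) => k; rewrite ler_distl; apply/andP; split.
  by rewrite lerBlDr; apply: ge_sup => // _ [j _ <-].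
rewrite -lerBlDr; apply: ub_le_sup; last by exists k.
by exists (u 0%N + K 0%N) => _ [j _ <-].
Qed.

Lemma le0_geometric (a K rho : R) : 0 < rho < 1 ->
  (forall k, a <= K * rho ^+ k) -> a <= 0.
Proof.
move=> /andP[rho0 rho1] aK.
have c0 : (K * rho ^+ k @[k --> \oo] --> K * 0)%classic.
  by apply: cvgM; [exact: cvg_cst|apply: cvg_expr; rewrite gtr0_norm].
by have := cvgr_to_ge c0; rewrite mulr0; apply; near=> k; exact: aK.
Unshelve. all: by end_near. Qed.

Lemma geometric_limit_vector m (u : nat -> 'cV[R]_m) (c rho : R) :
  0 <= c -> 0 < rho < 1 ->
  (forall k, dot (u k.+1 - u k) (u k.+1 - u k) <= c * rho ^+ k) ->
  exists y K, forall k, dot (u k - y) (u k - y) <= K * rho ^+ k.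
Proof.
move=> c0 /andP[rho0 rho1] uc; pose q := Num.sqrt rho.
have q2 : q ^+ 2 = rho by rewrite sqr_sqrtr// ltW.
have q01 : 0 < q < 1.
  by rewrite sqrtr_gt0 rho0/= -[ltRHS]sqrtr1 ltr_sqrt.
have lims i : exists y, forall k, `|u k i 0 - y| <= Num.sqrt c / (1 - q) * q ^+ k.
  apply: geometric_limit => // k.
  rewrite -ler_sqr ?nnegrE ?mulr_ge0 ?sqrtr_ge0 ?exprn_ge0 ?sqrtr_ge0//.
  rewrite real_normK ?num_real// exprMn sqr_sqrtr// exprAC q2.
  by apply: le_trans (uc k); have := sqr_le_dot (u k.+1 - u k) i; rewrite !mxE.
have [y yP] := choice lims.
exists (\col_i y i), (\sum_(i < m) (Num.sqrt c / (1 - q)) ^+ 2) => k.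
rewrite mulr_suml; apply: ler_sum => i _; rewrite !mxE -expr2.
rewrite -q2 exprAC -exprMn -[leLHS]real_normK ?num_real// ler_sqr ?nnegrE//.
by apply: le_trans (yP i k).
Qed.

Lemma linearly_converges_sqr m (x : nat -> 'cV[R]_m) y (C rho : R) :
  0 <= C -> 0 < rho < 1 ->
  (forall k, dot (x k - y) (x k - y) <= C * rho ^+ k) -> linearly_converges x y.
Proof.
move=> C0 /andP[rho0 rho1] xC; exists (Num.sqrt C + 1), (Num.sqrt rho).
have C1 : 0 < Num.sqrt C + 1 by rewrite ltr_wpDl ?sqrtr_ge0.
split; rewrite ?sqrtr_gt0 ?C1// -?[ltRHS]sqrtr1 ?ltr_sqrt// => k.
have q0 : 0 <= Num.sqrt rho ^+ k by rewrite exprn_ge0 ?sqrtr_ge0.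
rewrite l2norm_le; last by rewrite mulr_ge0// ltW.
apply: le_trans (xC k) _; rewrite exprMn exprAC (sqr_sqrtr (ltW rho0)).
rewrite ler_wpM2r ?exprn_ge0 ?(ltW rho0)// sqrrD sqr_sqrtr//.
rewrite expr1n mulr1 -addrA lerDl.
by rewrite addr_ge0// mulrn_wge0// sqrtr_ge0.
Qed.

(* With [x = 2 alpha S / mu] and [y = 4 alpha m2 b / mu], so that [x + y <= 1],
   the weight [5 alpha m2 / mu] of the estimation error makes the coefficient of
   [D] at most [alpha mu (- 3 / 2 + x + 5 / 4 y^2)] and that of [e] at most
   [- alpha m2 / (8 mu)]. *)
Lemma lyapunov_arithmetic (alpha mu S m2 m4 S4 n2 b D e : R) :
  0 < alpha -> 0 < mu -> 0 < m2 -> 0 <= S -> 0 <= D -> 0 <= e ->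
  2 * mu ^+ 2 <= m2 -> S4 <= m2 * n2 -> n2 / 2 <= b -> 2 <= b ->
  alpha * (8 * mu * m4) <= 4 * m2 -> alpha * (2 * S + 4 * m2 * b) <= mu ->
  - (2 * alpha * mu * D) + alpha * (2^-1 * mu * D + mu^-1 * (m2 * e))
  + alpha ^+ 2 * (2 * (S * D + m2 * e))
  + 5 * alpha * m2 / mu *
    (b * (alpha ^+ 2 * (2 * (S4 * D + m4 * e))) - 2^-1 * e)
  <= - (alpha * mu / 4 * D) - alpha * m2 / (8 * mu) * e.
Proof.
move=> a0 mu0 m20 S0 D0 e0 mum2 S4n2 n2b b2 A1 A2.
have [w wE] : exists w, w = alpha * m2 / mu by exists (alpha * m2 / mu).
have w0 : 0 < w by rewrite wE divr_gt0// mulr_gt0.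
have am2 : alpha * m2 = w * mu by rewrite wE divfK// gt_eqF.
have A2' : alpha * (4 * m2 * b) <= mu.
  by apply: le_trans A2; rewrite ler_wpM2l ?(ltW a0)// lerDr mulr_ge0.
have b0 : 0 <= b by apply: le_trans b2.
have [x xS] : exists x, 2 * alpha * S = x * mu.
  by exists (2 * alpha * S / mu); rewrite divfK// gt_eqF.
have xy : x + 4 * w * b <= 1.
  by rewrite -(ler_pM2r mu0); move: A2 am2 xS; nra.
have x0 : 0 <= x by rewrite -(pmulr_lge0 _ mu0) -xS !mulr_ge0// ltW.
(* Multiply the first step-size bound by alpha b, then use the second. *)
have t8 : alpha ^+ 2 * b * m4 <= 8^-1.
  have h := ler_wpM2l (mulr_ge0 (ltW a0) b0) A1.
  rewrite -(ler_pM2l mu0); move: h A2'; lra.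
(* From b >= 2 the second bound gives 8 alpha m2 <= mu; then use m2 >= 2 mu^2. *)
have amu : alpha * mu <= 16^-1.
  have h1 := ler_wpM2l (mulr_ge0 (ltW a0) (ltW m20)) b2.
  have h2 := ler_wpM2l (ltW a0) mum2.
  rewrite -(ler_pM2l mu0); move: h1 h2 A2'; lra.
have De : alpha * (- mu * 2 + 2^-1 * mu + 2 * alpha * S + 10 * w * b * alpha * S4)
    <= - (alpha * mu / 4).
  have S4b : S4 <= m2 * (2 * b).
    by apply: le_trans S4n2 _; rewrite ler_wpM2l ?(ltW m20)//; lra.
  have wba0 : 0 <= 10 * w * b * alpha by rewrite !mulr_ge0 ?(ltW w0) ?(ltW a0)//.
  have h1 := ler_wpM2l wba0 S4b.
  have y0 : 0 <= 4 * w * b by rewrite !mulr_ge0 ?(ltW w0)//.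
  have h2 : (4 * w * b) ^+ 2 <= 4 * w * b by rewrite expr2 ler_piMr//; lra.
  have h3 := ler_wpM2l (ltW mu0) h2; have h4 := ler_wpM2l (ltW mu0) xy.
  have h5 : 10 * w * b * alpha * (m2 * (2 * b)) = 5 / 4 * (mu * (4 * w * b) ^+ 2).
    transitivity (20 * w * b ^+ 2 * (alpha * m2)); first by ring.
    by rewrite am2; field.
  have h6 := mulr_ge0 x0 (ltW mu0).
  rewrite (_ : - (alpha * mu / 4) = alpha * (- mu / 4)); last by field.
  rewrite ler_wpM2l ?(ltW a0)//; move: h1 h3 h4 xS; rewrite h5; lra.
(* The left side is at most (1 + 1/8 - 5/2 + 5/4) w. With weight kappa w on the error, these
   estimates make this coefficient negative for kappa > 9/2 and that of D for kappa < 6, whence the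
   choice 5. *)
have Ee : w + 2 * alpha ^+ 2 * m2 - 5 / 2 * w + 10 * w * (alpha ^+ 2 * b * m4)
    <= - (w / 8).
  have -> : 2 * alpha ^+ 2 * m2 = 2 * (w * (alpha * mu)).
    by transitivity (2 * alpha * (alpha * m2)); [ring|rewrite am2; ring].
  have h1 := ler_wpM2l (ltW w0) t8; have h2 := ler_wpM2l (ltW w0) amu; lra.
have h1 := ler_wpM2r D0 De; have h2 := ler_wpM2r e0 Ee.
have -> : 5 * alpha * m2 / mu = 5 * w by rewrite wE; ring.
have -> : alpha * m2 / (8 * mu) = w / 8 by rewrite wE; field; lra.
have -> : mu^-1 * (m2 * e) = w * e / alpha by rewrite wE; field; lra.
have -> : alpha * (2^-1 * mu * D + w * e / alpha) = alpha * (2^-1 * mu * D) + w * e.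
  by field; lra.
lra.
Qed.
End geometric.

(** * Existence of the equilibrium and one step of the multiplier *)

Section convergence.
Context {R : realType} {N : nat} {n : 'I_N -> nat}.
Variables (f : agent n -> 'cV[R]_(nsum n) -> R) (r : 'cV[R]_(nsum n)).
Variables (l : agent n -> R) (mu : R) (E : rel (agent n)) (alpha : R).
Hypothesis special : special_game f.
Hypothesis smooth : smooth_convex f l.
Hypothesis monotone : strongly_monotone_game f mu.
Hypothesis netE : connected_network E.
Hypothesis alpha0 : 0 < alpha.

Local Notation L := (coalition_laplacian (R := R) E).
Local Notation P := (pseudo_gradient f).
Let S : R :=
  \sum_i coalition_lipschitz l i ^+ 2 * opnorm (laplacian R E i) ^+ 2.
Hypothesis alphaS : alpha * (2 * S) <= mu.

Let mu0 : 0 < mu. Proof. by case: monotone. Qed.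

Let l0 s : 0 <= l s.
Proof.
by apply: le_trans (mono_const_le_lipschitz special smooth monotone s); exact: ltW.
Qed.

Lemma block_sqn_pseudo_gradient i y z : block_sqn i (P y - P z) <=
  coalition_lipschitz l i ^+ 2 * dot (y - z) (y - z).
Proof.
apply: block_sqn_lipschitz_le_const => // [|s]; first exact: dot_ge0.
rewrite mxE [X in _ + X]mxE !(pseudo_gradientE special smooth).
exact: partial_lipschitz.
Qed.

Let sqn_laplacian_pseudo_gradient y z :
  dot (L *m (P y - P z)) (L *m (P y - P z)) <= 2 * S * dot (y - z) (y - z).
Proof.
have := @sqn_laplacian_le R N n E l (P y - P z) 0 (dot (y - z) (y - z)) (fun=> 0).
have -> : \sum_(i < N) (0 : R) = 0 by exact: big1_eq.
rewrite addr0 mulr0 addr0 mulrA; apply => // i.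
  exact: block_sqn_pseudo_gradient.
by rewrite /block_sqn mulr0 big1// => s _; rewrite mxE expr0n.
Qed.

Let S0 : 0 <= S.
Proof. by apply: sumr_ge0 => i _; rewrite mulr_ge0 ?sqr_ge0. Qed.

Let opp_laplacian_sqn (y z : 'cV[R]_(nsum n)) :
  dot ((r - L *m y) - (r - L *m z)) ((r - L *m y) - (r - L *m z)) =
  dot (L *m (y - z)) (L *m (y - z)).
Proof.
rewrite (_ : r - L *m y - (r - L *m z) = - (L *m (y - z))).
  by rewrite dotNl dotNr opprK.
by rewrite mulmxBr !opprB [LHS]addrC addrA subrK.
Qed.

(* The iteration [eta <- eta + alpha L P (r - L eta)] contracts on the range
   of L, where [eta] is controlled by [L eta]. *)
Lemma equilibrium_multiplier_exists : exists w : 'cV[R]_(nsum n),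
  L *m P (r - L *m (L *m w)) = 0.
Proof.
have [B LB] := @symmetric_pinv R _ _ (coalition_laplacian_sym netE).
have [y yS] : exists y : nat -> 'cV[R]_(nsum n),
    forall k, y k.+1 = y k + alpha *: (L *m P (r - L *m y k)).
  by exists (fun k => iter k (fun v => v + alpha *: (L *m P (r - L *m v))) 0).
have [x xE] : exists x, forall k, x k = r - L *m y k.
  by exists (fun k => r - L *m y k).
have [z zE] : exists z, forall k, z k = alpha *: (L *m P (x k)).
  by exists (fun k => alpha *: (L *m P (x k))).
have yz k : y k.+1 - y k = z k by rewrite yS zE xE addrC addKr.
have dx k : x k.+1 - x k = - (L *m z k).
  by rewrite !xE -yz mulmxBr !opprB [LHS]addrC addrA subrK.
have zB k : dot (z k) (z k) <= (opnorm B ^+ 2 + 1) * dot (L *m z k) (L *m z k).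
  have zBL : z k = B *m (L *m z k).
    by rewrite zE -!scalemxAr {1}LB -!mulmxA.
  rewrite {1 2}zBL; apply: le_trans (sqn_mulmx_le _ _) _.
  by rewrite ler_wpM2r ?dot_ge0// lerDl.
(* As x moves by - L z, monotonicity makes the cross term at most - 2 alpha mu |L z|^2; the
   quadratic term is at most alpha^2 2 S |L z|^2 <= alpha mu |L z|^2. *)
have dz k : dot (z k.+1) (z k.+1) <=
    dot (z k) (z k) - alpha * mu * dot (L *m z k) (L *m z k).
  have -> : z k.+1 = z k + alpha *: (L *m (P (x k.+1) - P (x k))).
    by rewrite !zE mulmxBr scalerBr addrCA subrr addr0.
  have := sqn_laplacian_pseudo_gradient (x k.+1) (x k).
  case: monotone => _ /(_ (x k.+1) (x k)).
  rewrite l2norm_sq dotE dx !dotNl !dotNr !opprK; set d := P _ - P _.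
  rewrite !dot_lin (dotC _ (z k)) -(dot_coalition_laplacian netE (z k)).
  set X := dot (L *m z k) (L *m z k) => h1 h2.
  have X0 : 0 <= X by exact: dot_ge0.
  have h3 := ler_wpM2l (ltW alpha0) h1.
  have h4 := ler_wpM2l (sqr_ge0 alpha) h2.
  have h5 := ler_wpM2l (mulr_ge0 (ltW alpha0) X0) alphaS.
  rewrite -dotBr -/d in h3; lra.
have [|rho rho01 zrho] := geometric_decay (mulr_gt0 alpha0 mu0)
   (ltr_wpDl (sqr_ge0 (opnorm B)) ltr01) _ zB dz; first by move=> k; exact: dot_ge0.
have [ys [K yK]] : exists ys K, forall k, dot (y k - ys) (y k - ys) <= K * rho ^+ k.
  by apply: (geometric_limit_vector (dot_ge0 (z 0%N)) rho01) => k; rewrite yz.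
(* Transposing L = B L L gives L L B^T = L, so L (B^T ys) is a multiplier in the range of L with the
   same image as the limit ys. *)
exists (B^T *m ys).
have -> : L *m (L *m (B^T *m ys)) = L *m ys.
  have LBt : L *m L *m B^T = L.
    by have := congr1 trmx LB; rewrite !trmx_mul (coalition_laplacian_sym netE).
  by rewrite !mulmxA LBt.
set xs := r - L *m ys.
apply: dot_eq0; apply/eqP; rewrite eq_le dot_ge0 andbT.
(* Split L P xs into L P (x k), which is z k / alpha, and a remainder controlled by |y k - ys|; both
   squares decay like rho^k. *)
apply: (le0_geometric (K := 2 / alpha ^+ 2 * dot (z 0%N) (z 0%N)
  + 4 * S * (opnorm L ^+ 2 * K)) rho01) => k.
have -> : L *m P xs = L *m P (x k) + L *m (P xs - P (x k)).
  by rewrite mulmxBr addrC subrK.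
apply: (@le_trans _ _ (2 * dot (L *m P (x k)) (L *m P (x k)) +
  2 * dot (L *m (P xs - P (x k))) (L *m (P xs - P (x k))))).
  have := @dot_young _ _ 1 (L *m P (x k)) (L *m (P xs - P (x k))) ltr01.
  rewrite dotDl !dotDr (dotC (L *m (P xs - P (x k))) (L *m P (x k))) invr1; lra.
rewrite [leRHS]mulrDl; apply: lerD.
  have := zrho k; rewrite zE !dot_lin; set a := dot _ _ => h.
  have a2 : 0 <= 2 / alpha ^+ 2 by rewrite divr_ge0 ?sqr_ge0.
  have := ler_wpM2l a2 h; rewrite [X in _ <= X]mulrA; apply: le_trans.
  by rewrite le_eqVlt; apply/orP; left; apply/eqP; field; rewrite gt_eqF.
have h1 := sqn_laplacian_pseudo_gradient xs (x k).
rewrite xE opp_laplacian_sqn in h1; rewrite xE.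
have h2 := sqn_mulmx_le L (ys - y k).
have h3 : dot (ys - y k) (ys - y k) <= K * rho ^+ k.
  by have := yK k; rewrite -[y k - ys]opprB dotNl dotNr opprK.
have h4 := ler_wpM2l (sqr_ge0 (opnorm L)) h3.
have h5 := ler_wpM2l S0 (le_trans h2 h4).
rewrite -!mulrA in h5 *; move: h1 h5; lra.
Qed.

(** As L P xs = 0, the update is driven by P x - P xs + u. After expansion of the square, strong
    monotonicity bounds the exact part of the cross term, Young's inequality its part in u, and
    [sqn_laplacian_le] the quadratic term. *)
Lemma multiplier_step (xs x zeta u : 'cV[R]_(nsum n)) (e : 'I_N -> R) :
  let D := dot (L *m zeta) (L *m zeta) in
  let m2 := \big[Num.max/0]_i
    (coalition_lipschitz l i ^+ 2 * opnorm (laplacian R E i) ^+ 2) in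
  L *m P xs = 0 -> x - xs = - (L *m zeta) -> (forall i, 0 <= e i) ->
  (forall i, block_sqn i u <= coalition_lipschitz l i ^+ 2 * e i) ->
  dot (zeta + alpha *: (L *m (P x + u))) (zeta + alpha *: (L *m (P x + u))) <=
  dot zeta zeta - 2 * alpha * mu * D
  + alpha * (2^-1 * mu * D + mu^-1 * (m2 * \sum_i e i))
  + alpha ^+ 2 * (2 * (S * D + m2 * \sum_i e i)).
Proof.
move=> D m2 LP dx e0 ue; pose p := P x - P xs.
have D0 : 0 <= D by exact: dot_ge0.
have -> : L *m (P x + u) = L *m (p + u).
  by rewrite /p addrAC mulmxBr LP subr0.
have pD i : block_sqn i p <= coalition_lipschitz l i ^+ 2 * D.
  by have := block_sqn_pseudo_gradient i x xs; rewrite dx dotNl dotNr opprK.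
have h1 := sqn_laplacian_le E e0 pD ue.
have h2 := dot_laplacian_perturbation_le netE e0 ue zeta mu0.
case: monotone => _ /(_ x xs); rewrite l2norm_sq dotE dx !dotNl !dotNr !opprK.
rewrite -/p -/D => h3.
rewrite dotDl !dotDr !dotZl !dotZr (dotC _ zeta).
rewrite -(dot_coalition_laplacian netE zeta).
rewrite dotDr.
have h4 := ler_wpM2l (ltW alpha0) h3.
have h5 := ler_wpM2l (ltW alpha0) h2.
have h6 := ler_wpM2l (sqr_ge0 alpha) h1.
rewrite -/S -/m2 -/D in h5 h6 *; lra.
Qed.

End convergence.

(** The coefficients of each estimate update sum to 1, so exact estimates of x are reproduced; the
    only forcing term is the move of x during the step. *)
Lemma estimator_error_step (R : realType) (N : nat) (n : 'I_N -> nat)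
    (E : rel (agent n)) (W : 'M[R]_(nsum n)) (x x' : 'cV[R]_(nsum n))
    (xi xi' : 'M[R]_(nsum n)) :
  (forall s t, xi' s t = wbar E W s t * xi s t
    + \sum_(u in neighbors E s) W s u * xi u t + W s t * x t 0) ->
  weight_matrix E W ->
  vecmx (xi' - \matrix_(s, t) x' t 0) =
  estimator_mx E W *m vecmx (xi - \matrix_(s, t) x t 0)
  - vecmx (\matrix_(s, t) (x' - x) t 0).
Proof.
move=> xiS hW; rewrite (estimator_vecmx hW) -vecmxB; congr vecmx.
apply/matrixP => s t; rewrite !mxE xiS.
rewrite [X in _ = _ + X - _](_ : _ = \sum_(u in neighbors E s) W s u * xi u t
   - (\sum_(u in neighbors E s) W s u) * x t 0); last first.
  by rewrite mulr_suml -sumrB; apply: eq_bigr => u _; rewrite !mxE mulrBr.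
rewrite /wbar; ring.
Qed.

(** Every agent tracks the same move of x; this is the source of the factor n_sum in b. *)
Lemma sqn_const_rows (R : realType) m (v : 'cV[R]_m) :
  dot (vecmx (\matrix_(s < m, t < m) v t 0))
    (vecmx (\matrix_(s < m, t < m) v t 0)) =
  m%:R * dot v v.
Proof.
rewrite dot_vecmx mulr_natl -[X in _ *+ X](card_ord m) -sumr_const.
by apply: eq_bigr => s _; apply: eq_bigr => t _; rewrite !mxE.
Qed.

Theorem theorem1 (R : realType) (N : nat) (n : 'I_N -> nat)
    (hN : (0 < N)%N) (hn : forall i, (0 < n i)%N)
    (f : agent n -> 'cV[R]_(nsum n) -> R) (r : 'cV[R]_(nsum n))
    (l : agent n -> R) (mu : R)
    (E : rel (agent n)) (W : 'M[R]_(nsum n))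
    (WM : 'M[R]_(nsum n * nsum n)) (alpha : R)
    (x eta : nat -> 'cV[R]_(nsum n)) (xi : nat -> 'M[R]_(nsum n)) :
  special_game f ->
  smooth_convex f l -> strongly_monotone_game f mu -> connected_network E ->
  weight_matrix E W ->
  posdef WM ->
  (estimator_mx E W)^T *m WM *m estimator_mx E W - WM = - 1%:M ->
  algorithm f r E W alpha x eta xi ->
  0 < alpha -> alpha <= step_bound E l mu W WM ->
  (exists2 xs : 'cV[R]_(nsum n),
      unique (is_NE f r) xs & linearly_converges x xs) /\
  (forall (i : 'I_N) (k : nat),
      \sum_(j < n i) x k (tagnat.Rank i j) 0 = coalition_resource r i).
Proof.
move=> special smooth monotone netE hW pdWM MWM [[x0 eta0] xE etaE xiE] alpha0 step.
pose L := coalition_laplacian (R := R) E; pose P := pseudo_gradient f.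
have mu0 : 0 < mu by case: monotone.
have xL k : x k = r - L *m eta k.
  apply/matrixP => s c; rewrite {c}ord1 xE x0 [RHS]mxE [X in _ = _ + X]mxE.
  by rewrite (coalition_laplacianE netE).
have sum_x i k : \sum_(s | tagnat.sig1 s == i) (x k - r) s 0 = 0.
  by have := sum_coalition_laplacian netE (- eta k) i;
    rewrite mulmxN xL addrAC subrr add0r.
split; last first.
  move=> i k; have := sum_x i k; rewrite -feasible_submxcol /feasible/= => <-.
  by apply: eq_bigr => j _; rewrite submxcolE.
pose lip i := coalition_lipschitz l i; pose Lam i := opnorm (laplacian R E i).
pose S : R := \sum_i lip i ^+ 2 * Lam i ^+ 2.
pose S4 : R := \sum_i lip i ^+ 2 * Lam i ^+ 4.
pose m2 : R := \big[Num.max/0]_i (lip i ^+ 2 * Lam i ^+ 2).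
pose m4 : R := \big[Num.max/0]_i (lip i ^+ 2 * Lam i ^+ 4).
pose b := bconst E W WM.
have l0 s : 0 <= l s.
  by rewrite (le_trans (ltW mu0))//
    (mono_const_le_lipschitz special smooth monotone).
have term0 i : 0 <= lip i ^+ 2 * Lam i ^+ 2 by rewrite mulr_ge0 ?sqr_ge0.
have m2_ge0 : 0 <= m2 by exact: bigmax_ge_id.
have m4_ge0 : 0 <= m4 by exact: bigmax_ge_id.
have S_ge0 : 0 <= S by exact: sumr_ge0.
have [step1 step2] : alpha <= 4 * m2 / (8 * mu * m4) /\
    alpha <= mu / (2 * S + 4 * m2 * b).
  by move: step; rewrite /step_bound le_min => /andP[].
(* With m2 = 0 the first bound would read alpha <= 0. Hence some coalition has a nonzero Laplacian,
   and there are at least two agents. *)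
have m2_gt0 : 0 < m2.
  rewrite lt_def m2_ge0 andbT; apply/eqP => m20.
  by move: step1; rewrite m20 mulr0 mul0r leNgt alpha0.
have [i0 Lam2] : exists i, 2 <= Lam i ^+ 2.
  apply: contrapT => none; move: m2_gt0; rewrite ltNge => /negP; apply.
  apply: bigmax_le => // i _.
  case: (laplacian_dichotomy (R := R) netE i) => [Lam2|Li0].
    by exfalso; apply: none; exists i.
  by rewrite /Lam Li0 opnorm0 expr0n mulr0.
have n1 : (1 < nsum n)%N.
  rewrite ltnNge; apply/negP => n1; move: Lam2; rewrite leNgt => /negP; apply.
  have Lam1 : Lam i0 <= 1.
    apply: le_trans (opnorm_laplacian_le (R := R) netE i0) _.
    by rewrite lern1 (leq_trans _ n1)// (bigD1 i0)//= leq_addr.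
  apply: (@le_lt_trans _ _ 1); last by rewrite ltr1n.
  by rewrite expr_le1// opnorm_ge0.
have b_ge := bconst_ge hW n1 pdWM MWM.
have b2 : 2 <= b.
  apply: le_trans b_ge.
  have : 2 <= (nsum n)%:R :> R by rewrite ler_nat.
  by set m := _%:R; nra.
have b0 : 0 < b by rewrite (lt_le_trans _ b2).
have mum2 : 2 * mu ^+ 2 <= m2.
  apply: (@le_trans _ _ (lip i0 ^+ 2 * Lam i0 ^+ 2)).
    2: exact: (le_bigmax _ (fun i => lip i ^+ 2 * Lam i ^+ 2)).
  rewrite mulrC; apply: ler_pM; rewrite ?sqr_ge0//.
  have := lipschitz_le_coalition l0 (tagnat.Rank i0 (Ordinal (hn i0))).
  rewrite tagnat.Rank1K => ls.
  have := mono_const_le_lipschitz special smooth monotone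
    (tagnat.Rank i0 (Ordinal (hn i0))).
  move=> /le_trans/(_ ls) mul; rewrite ler_sqr ?nnegrE ?(ltW mu0)//.
  exact: le_trans (ltW mu0) mul.
have A1 : alpha * (8 * mu * m4) <= 4 * m2.
  (* Division by 0 yields 0, so m4 = 0 would also force alpha <= 0. *)
  have m4_gt0 : 0 < m4.
    rewrite lt_def m4_ge0 andbT; apply/eqP => m40.
    by move: step1; rewrite m40 mulr0 invr0 mulr0 leNgt alpha0.
  by move: step1; rewrite ler_pdivlMr// !mulr_gt0.
have A2 : alpha * (2 * S + 4 * m2 * b) <= mu.
  have den0 : 0 < 2 * S + 4 * m2 * b.
    apply: ltr_wpDl; first by rewrite mulr_ge0.
    by rewrite mulr_gt0// mulr_gt0.
  by move: step2; rewrite ler_pdivlMr.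
have alphaS : alpha * (2 * S) <= mu.
  apply: le_trans A2; rewrite ler_wpM2l ?(ltW alpha0)// lerDl.
  by apply: mulr_ge0 (ltW b0); rewrite mulr_ge0.
have [w] := equilibrium_multiplier_exists r special smooth monotone netE
  alpha0 alphaS.
rewrite -/L -/P; set etas := L *m w; set xs := r - L *m etas => LP0.
have eqm : equal_marginals f xs by exact: (ker_coalition_laplacian netE LP0).
have xs_feasible i : \sum_(s | tagnat.sig1 s == i) (xs - r) s 0 = 0.
  by have := sum_coalition_laplacian netE (- etas) i;
    rewrite mulmxN /xs addrAC subrr add0r.
have xsNE : is_NE f r xs.
  by apply: (equal_marginals_NE smooth) => // i; apply/feasible_submxcol.
exists xs.
  by split=> // y yNE; exact: (NE_unique smooth monotone xsNE yNE).
pose e k := xi k - \matrix_(s, t) x k t 0.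
pose g k : 'cV[R]_(nsum n) := \col_s partial (f s) s (estimate_arg (xi k) s).
have etaS k : eta k.+1 = eta k + alpha *: (L *m g k).
  apply/matrixP => s c; rewrite {c}ord1 etaE [RHS]mxE; congr (_ + _).
  rewrite [RHS]mxE (coalition_laplacianE netE); congr (_ * _).
  by apply: eq_bigr => t _; rewrite !mxE.
pose zeta k := eta k - etas.
have dE k : x k - xs = - (L *m zeta k).
  by rewrite xL /xs mulmxBr !opprB [LHS]addrC addrA subrK.
pose u k := g k - P (x k).
pose err k i := \sum_(s | tagnat.sig1 s == i) \sum_t e k s t ^+ 2.
have ue k i : block_sqn i (u k) <= lip i ^+ 2 * err k i.
  apply: block_sqn_lipschitz_le => // s.
    by apply: sumr_ge0 => t _; exact: sqr_ge0.
  rewrite mxE [X in _ + X]mxE (pseudo_gradientE special smooth) [g k _ _]mxE.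
  (* Replacing the argument by the full row of estimates changes only coordinates that f_s ignores;
     the distance to x k is then the norm of row s of the error. *)
  rewrite (special_partial special (z := (row s (xi k))^T)).
  - apply: le_trans (partial_lipschitz smooth _ _ _) _.
    rewrite ler_wpM2l ?sqr_ge0//; apply: ler_sum => t _.
    by rewrite !mxE expr2.
  - by rewrite !mxE eqxx.
  - by move=> t ts; rewrite !mxE ts orbT.
have err0 k i : 0 <= err k i.
  by apply: sumr_ge0 => s _; apply: sumr_ge0 => t _; exact: sqr_ge0.
pose D k := dot (L *m zeta k) (L *m zeta k).
pose ee k := dot (vecmx (e k)) (vecmx (e k)).
have ee_err k : ee k = \sum_i err k i.
  rewrite -sum_by_coalition /ee dot_vecmx; apply: eq_bigr => s _.
  by apply: eq_bigr => t _; rewrite expr2.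
have D0 k : 0 <= D k by exact: dot_ge0.
have ee0 k : 0 <= ee k by exact: dot_ge0.
have zetaS k : zeta k.+1 = zeta k + alpha *: (L *m (P (x k) + u k)).
  by rewrite /zeta etaS /u [P _ + _]addrC subrK addrAC.
have dx k : x k.+1 - x k = - (alpha *: (L *m (L *m (P (x k) - P xs + u k)))).
  have -> : alpha *: (L *m (L *m (P (x k) - P xs + u k))) =
      L *m (eta k.+1 - eta k).
    rewrite etaS [eta k + _]addrC addrK -scalemxAr; congr (_ *: (_ *m _)).
    by rewrite addrAC mulmxBr LP0 subr0 /u [P _ + _]addrC subrK.
  by rewrite !xL mulmxBr !opprB [LHS]addrC addrA subrK.
have eS k : vecmx (e k.+1) = estimator_mx E W *m vecmx (e k)
    - vecmx (\matrix_(s, t) (x k.+1 - x k) t 0).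
  exact: estimator_error_step.
pose c := 5 * alpha * m2 / mu.
have c0 : 0 < c by rewrite divr_gt0// !mulr_gt0.
pose Ve k := dot (vecmx (e k)) (WM *m vecmx (e k)).
pose V k := dot (zeta k) (zeta k) + c * Ve k.
(* The two decrease rates of [lyapunov_arithmetic], for D and for the estimation error. *)
pose eps := Num.min (alpha * mu / 4) (alpha * m2 / (8 * mu)).
have eps0 : 0 < eps by rewrite lt_min !divr_gt0// !mulr_gt0.
have dVe k : Ve k.+1 <= Ve k - 2^-1 * ee k +
    b * (alpha ^+ 2 * (2 * (S4 * D k + m4 * ee k))).
  have := lyapunov_estimator (vecmx (e k))
    (vecmx (\matrix_(s, t) (x k.+1 - x k) t 0)) pdWM MWM.
  rewrite -eS -/(Ve k.+1) -/(Ve k) -/(ee k) sqn_const_rows => /le_trans; apply.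
  rewrite lerD2l mulrA [_ * (nsum n)%:R]mulrC -/(bconst E W WM) -/b.
  rewrite ler_wpM2l ?(ltW b0)// dx dotNl dotNr opprK dotZl dotZr mulrA -expr2.
  rewrite ler_wpM2l ?sqr_ge0// ee_err; apply: sqn_laplacian2_le => // i.
  have := block_sqn_pseudo_gradient special smooth monotone i (x k) xs.
  by rewrite dE dotNl dotNr opprK.
have dV k : V k.+1 <= V k - eps * (D k + ee k).
  have h1 := multiplier_step special smooth monotone netE alpha0 LP0 (dE k)
    (err0 k) (ue k).
  rewrite -zetaS -/(D k) -ee_err -/m2 -/S in h1.
  have h2 := ler_wpM2l (ltW c0) (dVe k).
  have S4n := sum_lipschitz_laplacian4_le (R := R) netE l.
  have h3 := lyapunov_arithmetic alpha0 mu0 m2_gt0 S_ge0 (D0 k) (ee0 k) mum2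
    S4n b_ge b2 A1 A2.
  have h4 : eps * D k <= alpha * mu / 4 * D k.
    by rewrite ler_wpM2r// ge_min lexx.
  have h5 : eps * ee k <= alpha * m2 / (8 * mu) * ee k.
    by rewrite ler_wpM2r// ge_min lexx orbT.
  rewrite -/S4 -/c -/b in h3; rewrite /V; lra.
have [B LB] := @symmetric_pinv R _ L (coalition_laplacian_sym netE).
(* The start eta 0 = 0 keeps every eta k in the range of L, which also contains etas = L w; B
   inverts L there. *)
have zetaB k : zeta k = B *m (L *m zeta k).
  have range v : L *m v = B *m (L *m (L *m v)) by rewrite {1}LB -!mulmxA.
  have etaB : eta k = B *m (L *m eta k).
    elim: k => [|k IH]; first by rewrite eta0 !mulmx0.
    by rewrite etaS !mulmxDr -!scalemxAr -range -IH.
  by rewrite /zeta !mulmxBr -etaB /etas -range.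
have VQ k : V k <= (opnorm B ^+ 2 + c * opnorm WM + 1) * (D k + ee k).
  have h1 : dot (zeta k) (zeta k) <= opnorm B ^+ 2 * D k.
    by rewrite {1 2}zetaB; exact: sqn_mulmx_le.
  have h2 := ler_wpM2l (ltW c0) (dot_mulmx_le WM (vecmx (e k))).
  have h3 : 0 <= opnorm B ^+ 2 * ee k by rewrite mulr_ge0 ?sqr_ge0.
  have h4 : 0 <= c * opnorm WM * D k.
    by rewrite mulr_ge0// mulr_ge0 ?opnorm_ge0// ltW.
  have h5 := D0 k; have h6 := ee0 k.
  rewrite -/(Ve k) -/(ee k) in h2; rewrite /V; lra.
have Ve0 k : 0 <= Ve k.
  rewrite /Ve; have [->|en0] := eqVneq (vecmx (e k)) 0; first by rewrite dot0l.
  by case: pdWM => _ /(_ _ en0)/ltW; rewrite -mulmxA dotE.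
have V0 k : 0 <= V k by rewrite addr_ge0 ?dot_ge0// mulr_ge0// ltW.
have C0 : 0 < opnorm B ^+ 2 + c * opnorm WM + 1.
  by rewrite ltr_wpDl// addr_ge0 ?sqr_ge0// mulr_ge0 ?opnorm_ge0// ltW.
have [rho rho01 Vrho] := geometric_decay eps0 C0 V0 VQ dV.
apply: (@linearly_converges_sqr _ _ _ _ (opnorm L ^+ 2 * V 0%N) rho) => //.
  by rewrite mulr_ge0 ?sqr_ge0.
move=> k; rewrite dE dotNl dotNr opprK -mulrA.
apply: le_trans (sqn_mulmx_le _ _) _; rewrite ler_wpM2l ?sqr_ge0//.
by apply: le_trans (Vrho k); rewrite lerDl mulr_ge0// ltW.
Qed.
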